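(* Let $n\ge1$, $\delta>0$ and $\beta<n+2$. Let, for $\nu\in\mathbb{R}^n$, $$\lambda_1(\nu)=-\|\nu\|^2\Big(3\mu\,{}_3F_4\big(1,\tfrac52,\tfrac{n+2-\beta}{2};2,\tfrac32,\tfrac{n+4}{2},\tfrac{n+4-\beta}{2};-\tfrac14\|\nu\|^2\delta^2\big)+(\lambda^*-\mu)\,{}_1F_2\big(\tfrac{n+2-\beta}{2};\tfrac{n+2}{2},\tfrac{n+4-\beta}{2};-\tfrac14\|\nu\|^2\delta^2\big)^2\Big).$$ Then, as $\|\nu\|\to\infty$, $$\lambda_1(\nu)\sim -(\lambda^*-\mu)\left[\frac{\Gamma(\frac{n+2}{2})\Gamma(\frac{n+4-\beta}{2})}{\Gamma(\frac{\beta}{2})}\right]^2\left(\frac2\delta\right)^{2(n+2-\beta)}\|\nu\|^{2(\beta-(n+1))}+R(\nu),$$ where $$R(\nu)=\begin{cases}\displaystyle-\mu\frac{2(n+2-\beta)(n+2)}{\delta^2(n-\beta)}-2\mu\frac{n-\beta-1}{n-\beta}\,\frac{\Gamma(\frac{n+4}{2})\Gamma(\frac{n+4-\beta}{2})}{\Gamma(\frac{\beta+2}{2})}\left(\frac2\delta\right)^{n+2-\beta}\|\nu\|^{\beta-n}&\text{if }\beta\neq n,\\[2ex]\displaystyle-\frac{2\mu}{\delta^2}(n+2)\left(2\log\|\nu\|+\log\left(\frac{\delta^2}{4}\right)+\gamma+2-\psi\left(\frac{n+2}{2}\right)\right)&\text{if }\beta=n,\end{cases}$$ $\gamma$ is Euler's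 constant and $\psi$ is the digamma function.
   Context: The generalized hypergeometric function is ${}_pF_q(a_1,\dots,a_p;b_1,\dots,b_q;x)=\sum_{m\ge0}\frac{(a_1)_m\cdots(a_p)_m}{(b_1)_m\cdots(b_q)_m}\frac{x^m}{m!}$, with $(a)_m=a(a+1)\cdots(a+m-1)$. The Lamé parameters $\mu>0$ and $\lambda^*\in\mathbb{R}$ are constants, assumed such that $\lambda_1(\nu)<0$ for all $\nu\ne0$. $1/\Gamma$ is read as the entire function (value $0$ at nonpositive integers). $f(\nu)\sim g(\nu)$ as $\|\nu\|\to\infty$ means $f(\nu)/g(\nu)\to1$. ($\lambda_1(\nu)$ is the eigenvalue, on the direction of $\nu$, of the Fourier multiplier of the linear state-based peridynamic operator with horizon $\delta$ and kernel exponent $\beta$.) *)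

(* Defs.v *)
(* Real analysis is done over the reals R of Stdlib with Coquelicot; the
   matrix type 'rV[R]_n of MathComp provides the vectors of R^n. *)
From mathcomp Require Import all_boot matrix.
From Stdlib Require Import Reals Factorial.
From Coquelicot Require Import Coquelicot.

Set Implicit Arguments.
Unset Strict Implicit.
Unset Printing Implicit Defensive.

Open Scope R_scope.

(* (a)_m = a (a+1) ... (a+m-1). *)
Fixpoint pochhammer (a : R) (m : nat) : R :=
  match m with
  | O => 1
  | S k => pochhammer a k * (a + INR k)
  end.

Definition pochhammers (a : list R) (m : nat) : R :=
  List.fold_right Rmult 1 (List.map (fun ai => pochhammer ai m) a).

(* The lists give the upper and lower parameters, so p and q are their
   lengths.  Series is total; for p <= q and no nonpositive integer in b the
   series converges for every x. *)
Definition hypergeom (a b : list R) (x : R) : R :=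
  Series (fun m => pochhammers a m / pochhammers b m * (x ^ m / INR (Factorial.fact m))).

(* Euler's integral: this is Gamma(x) for x > 0 only. *)
Definition Gamma (x : R) : R :=
  RInt_gen (fun t => Rpower t (x - 1) * exp (- t))
           (at_right 0) (Rbar_locally p_infty).

(* The entire function 1/Gamma on the whole real line, by
   1/Gamma(x) = (x)_m / Gamma(x+m), where m is the least natural number with
   0 < x + m (up (-x) is the least integer greater than -x, and Z.to_nat sends
   negative integers to 0).  So it is / Gamma x for x > 0, and 0 at the
   nonpositive integers, where the factor x + (m - 1) of (x)_m vanishes. *)
Definition rGamma (x : R) : R :=
  let m := Z.to_nat (up (- x)) in pochhammer x m / Gamma (x + INR m).

(* The digamma function, for x > 0. *)
Definition digamma (x : R) : R := Derive Gamma x / Gamma x.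

(* lim_{N -> oo} (1 + 1/2 + ... + 1/(N+1) - log (N+1)). *)
Definition euler_gamma : R :=
  real (Lim_seq (fun N => sum_n (fun k => / INR (S k)) N - ln (INR (S N)))).

Definition enorm (n : nat) (nu : 'rV[R]_n) : R :=
  sqrt (\big[Rplus/0]_(i < n) ((nu ord0 i) ^ 2)).

(* The filter "||nu|| -> oo" on R^n. *)
Definition enorm_infty (n : nat) (P : 'rV[R]_n -> Prop) : Prop :=
  exists M : R, forall nu : 'rV[R]_n, M < enorm nu -> P nu.

(* Division by 0 does no harm: a limit equal to 1 forces g <> 0 near infinity,
   as / 0 = 0 in Stdlib. *)
Definition asymp_equiv (n : nat) (f g : 'rV[R]_n -> R) : Prop :=
  filterlim (fun nu => f nu / g nu) (@enorm_infty n) (locally 1).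

Definition lambda1 (n : nat) (delta beta mu lambdastar : R) (nu : 'rV[R]_n) : R :=
  let d := INR n in
  let z := - (1 / 4) * enorm nu ^ 2 * delta ^ 2 in
  - enorm nu ^ 2 *
    (3 * mu *
       hypergeom [:: 1; 5 / 2; (d + 2 - beta) / 2]
                 [:: 2; 3 / 2; (d + 4) / 2; (d + 4 - beta) / 2] z
     + (lambdastar - mu) *
       (hypergeom [:: (d + 2 - beta) / 2]
                  [:: (d + 2) / 2; (d + 4 - beta) / 2] z) ^ 2).

Definition remainder (n : nat) (delta beta mu : R) (nu : 'rV[R]_n) : R :=
  let d := INR n in
  if Req_dec_T beta d then
    - (2 * mu / delta ^ 2) * (d + 2) *
      (2 * ln (enorm nu) + ln (delta ^ 2 / 4) + euler_gamma + 2
       - digamma ((d + 2) / 2))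
  else
    - mu * (2 * (d + 2 - beta) * (d + 2) / (delta ^ 2 * (d - beta)))
    - 2 * mu * ((d - beta - 1) / (d - beta)) *
      (Gamma ((d + 4) / 2) * Gamma ((d + 4 - beta) / 2) * rGamma ((beta + 2) / 2)) *
      Rpower (2 / delta) (d + 2 - beta) * Rpower (enorm nu) (beta - d).

Definition lambda1_asymp (n : nat) (delta beta mu lambdastar : R)
    (nu : 'rV[R]_n) : R :=
  let d := INR n in
  - (lambdastar - mu) *
    (Gamma ((d + 2) / 2) * Gamma ((d + 4 - beta) / 2) * rGamma (beta / 2)) ^ 2 *
    Rpower (2 / delta) (2 * (d + 2 - beta)) *
    Rpower (enorm nu) (2 * (beta - (d + 1)))
  + remainder delta beta mu nu.

(* Main.v *)
Require Import Defs.
From mathcomp Require Import all_boot matrix.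
From Stdlib Require Import Reals Lra Lia.
From Coquelicot Require Import Coquelicot.
Open Scope R_scope.

(** Put x = (||nu|| delta / 2)^2, a = (n + 2 - beta) / 2 > 0, c = (n + 4) / 2.
    Let phi_c (x) = sum_m (-x)^m / (m! (c)_m) be the Bessel function of order
    c - 1 in the variable 2 sqrt x, normalized by phi_c (0) = 1.  For a power
    series f let W_a f be its average a int_0^1 t^(a-1) f(t x) dt, which
    multiplies the m-th coefficient by a / (a + m).  Cancelling Pochhammer
    symbols gives 1F2 = W_a phi_(c-1) and
    3 * 3F4 = 2 W_a phi_c + W_1 W_a phi_c, so that
    lambda_1 is - 4 mu / delta^2 times the [profile]
      x (2 W_a phi_c + W_1 W_a phi_c + k (W_a phi_(c-1))^2),  k = (lambda* - mu) / mu.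

    An equivalent only has to match the dominant term, and because n >= 1 and
    a > 0 that term always comes from 3F4.  For a <> 1, partial fractions turn
    W_1 W_a phi_c into a combination of W_1 phi_c and W_a phi_c, and
    x W_1 phi_c = (c - 1) (1 - phi_(c-1)) tends to c - 1.  Hence
    - for a > 1 (beta < n), x W_a phi_c -> 0 and the profile tends to a
      nonzero constant;
    - for a = 1 (beta = n), x W_1 W_1 phi_c is a primitive of W_1 phi_c, which
      behaves like (c - 1) / x, so the profile grows like (c - 1) ln x;
    - for a < 1 (beta > n), the profile grows like a multiple of x^(1-a),
      because x^a W_a phi_c tends to
      Gamma(c) Gamma(a+1) / Gamma(c-a) ([wavg_phi_lim]).
    In each case the squared 1F2 is negligible, and so is the term
    ||nu||^(2 (beta - n - 1)) of the claimed equivalent.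

    All decay estimates rest on one energy: for c >= 1/2,
    phi_c^2 + x (phi_c')^2 is nonincreasing ([phi_energy]).  It gives
    |phi_c| <= 1 and, since phi_c' = - phi_(c+1) / c, also
    |phi_(c+1)| <= c x^(-1/2).  Averages inherit power decay ([wavg_bound]),
    and integration by parts takes the form of algebraic identities between
    averages ([x_wavg_phi], [x_wavg1_phi]).

    The limit for a < 1 is the Mellin transform of phi_c.  That x^a W_a phi_c
    has some limit L, with error O(x^(a-1)), follows by one integration by
    parts.  To find L, replace x by t x and integrate against
    t^(c-a-1) e^(-t) dt: by the error bound this yields L Gamma(c-a) up to
    O(x^(a-1)), while term by term Gamma(c+m) = (c)_m Gamma(c) cancels the
    Pochhammer symbol and leaves Gamma(c) x^a W_a exp(-x), whose limit is
    Gamma(c) a Gamma(a).  The partial sums of phi_c envelop it, as those of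
    exp(-x) do ([phi_envelope]), and so only finite sums are integrated. *)

(** * Monotonicity and limits from derivatives *)

Lemma nondecreasing_of_derive_ge0 (F dF : R -> R) (x y : R) :
  (forall t, x <= t <= y -> is_derive F t (dF t)) ->
  (forall t, x <= t <= y -> 0 <= dF t) ->
  x <= y -> F x <= F y.
Proof.
intros HF Hd Hxy.
destruct (MVT_gen F x y dF) as [t [Ht E]].
- intros t; rewrite Rmin_left // Rmax_right //; intros Ht; apply HF; lra.
- intros t; rewrite Rmin_left // Rmax_right //; intros Ht.
  apply continuity_pt_filterlim; apply: ex_derive_continuous.
  exists (dF t); apply HF; lra.
- rewrite Rmin_left // Rmax_right // in Ht.
  assert (0 <= dF t * (y - x)); [|lra].
  apply Rmult_le_pos; [apply Hd; lra|lra].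
Qed.

Lemma lim0_le_of_derive_ge0 (F dF : R -> R) (l x : R) :
  filterlim F (at_right 0) (locally l) ->
  (forall t, 0 < t -> is_derive F t (dF t)) ->
  (forall t, 0 < t -> 0 <= dF t) ->
  0 < x -> l <= F x.
Proof.
intros Hl HF Hd Hx.
assert (H : Rbar_le l (F x)); [|exact H].
apply (filterlim_le (F := at_right 0) F (fun _ => F x)); auto.
- exists (mkposreal x Hx); intros y Hy Hy0.
  unfold ball in Hy; simpl in Hy; unfold AbsRing_ball, abs, minus, plus, opp in Hy; simpl in Hy.
  apply Rabs_def2 in Hy.
  apply (nondecreasing_of_derive_ge0 F dF); intros; try apply HF; try apply Hd; lra.
- apply filterlim_const.
Qed.

Lemma is_derive_Rpower (a x : R) :
  0 < x -> is_derive (fun t => Rpower t a) x (a * Rpower x (a - 1)).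
Proof.
intros Hx; apply is_derive_Reals; now apply derivable_pt_lim_power.
Qed.

Lemma Rpower_gt0 (x a : R) : 0 < Rpower x a.
Proof. apply exp_pos. Qed.

Lemma Rpower_lim0 (a : R) :
  0 < a -> filterlim (fun t => Rpower t a) (at_right 0) (locally 0).
Proof.
intros Ha; unfold Rpower.
apply (filterlim_comp _ _ _ (fun t => a * ln t) exp _ (Rbar_locally m_infty)).
2: exact is_lim_exp_m.
apply (filterlim_comp _ _ _ ln (fun t => a * t) _ (Rbar_locally m_infty)).
1: exact is_lim_ln_0.
assert (H := filterlim_Rbar_mult_l a m_infty).
replace (Rbar_mult a m_infty) with m_infty in H; [exact H|].
simpl; case: Rle_dec => [H1|]; [|lra].
by case: Rle_lt_or_eq_dec => [_|]; [|lra].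
Qed.

Lemma Rpower_lim_infty (a : R) :
  0 < a -> is_lim (fun t => Rpower t (- a)) p_infty 0.
Proof.
intros Ha; unfold Rpower.
apply (filterlim_comp _ _ _ (fun t => - a * ln t) exp _ (Rbar_locally m_infty)).
2: exact is_lim_exp_m.
apply (filterlim_comp _ _ _ ln (fun t => - a * t) _ (Rbar_locally p_infty)).
1: exact is_lim_ln_p.
assert (H := filterlim_Rbar_mult_l (- a) p_infty).
replace (Rbar_mult (- a) p_infty) with m_infty in H; [exact H|].
simpl; case: Rle_dec => [H1|_]; [exfalso; lra|reflexivity].
Qed.

(** F - K x^(-e) increases and F + K x^(-e) decreases, so every value of the
    former is below every value of the latter; L is the supremum of the former.
    The bound holds for every x > 0, which lets it be integrated later. *)
Lemma limit_of_derive_bound (F dF : R -> R) (K e : R) :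
  0 < e ->
  (forall t, 0 < t -> is_derive F t (dF t)) ->
  (forall t, 0 < t -> Rabs (dF t) <= K * e * Rpower t (- e - 1)) ->
  exists L, forall x, 0 < x -> Rabs (F x - L) <= K * Rpower x (- e).
Proof.
intros He HF Hd.
assert (D : forall s t, 0 < t ->
  is_derive (fun x => F x + s * Rpower x (- e)) t
            (dF t + s * (- e * Rpower t (- e - 1)))).
{ intros s t Ht.
  apply (is_derive_plus (V := R_NormedModule) F (fun x => s * Rpower x (- e))).
  - now apply HF.
  - apply (is_derive_scal (fun x => Rpower x (- e))); now apply is_derive_Rpower. }
assert (K0 : 0 <= K).
{ specialize (Hd 1 Rlt_0_1). assert (H := Rabs_pos (dF 1)).
  assert (P := Rpower_gt0 1 (- e - 1)).
  assert (P1 : 0 < e * Rpower 1 (- e - 1)) by (apply Rmult_lt_0_compat; lra).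
  apply Rnot_lt_le; intros N; assert (K * (e * Rpower 1 (- e - 1)) < 0); [|lra].
  apply Ropp_lt_cancel; rewrite -Ropp_mult_distr_l_reverse Ropp_0; apply Rmult_lt_0_compat; lra. }
assert (up : forall x y, 0 < x -> x <= y ->
   F x + - K * Rpower x (- e) <= F y + - K * Rpower y (- e)).
{ intros x y Hx Hxy.
  apply (nondecreasing_of_derive_ge0 (fun x => F x + - K * Rpower x (- e))
    (fun t => dF t + - K * (- e * Rpower t (- e - 1)))); auto.
  - intros t Ht; apply D; lra.
  - intros t Ht; assert (H := Hd t ltac:(lra)).
    apply Rabs_le_between in H. lra. }
assert (dn : forall x y, 0 < x -> x <= y ->
   - (F x + K * Rpower x (- e)) <= - (F y + K * Rpower y (- e))).
{ intros x y Hx Hxy.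
  apply (nondecreasing_of_derive_ge0 (fun x => - (F x + K * Rpower x (- e)))
    (fun t => - (dF t + K * (- e * Rpower t (- e - 1))))); auto.
  - intros t Ht; apply (is_derive_opp (V := R_NormedModule)); apply D; lra.
  - intros t Ht; assert (H := Hd t ltac:(lra)).
    apply Rabs_le_between in H. lra. }
assert (cross : forall x y, 0 < x -> 0 < y ->
   F x - K * Rpower x (- e) <= F y + K * Rpower y (- e)).
{ intros x y Hx Hy.
  assert (Px := Rmult_le_pos _ _ K0 (Rlt_le _ _ (Rpower_gt0 x (- e)))).
  assert (Py := Rmult_le_pos _ _ K0 (Rlt_le _ _ (Rpower_gt0 y (- e)))).
  destruct (Rle_dec x y) as [H|H].
  - assert (Q := up x y Hx H); lra.
  - assert (Q := dn y x Hy ltac:(lra)); lra. }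
destruct (completeness (fun z => exists x, 0 < x /\ z = F x - K * Rpower x (- e))) as [L [L1 L2]].
- exists (F 1 + K * Rpower 1 (- e)); intros z [x [Hx ->]]; apply cross; lra.
- exists (F 1 - K * Rpower 1 (- e)); exists 1; split; [lra|reflexivity].
- exists L; intros x Hx; apply Rabs_le_between; split.
  + assert (L <= F x + K * Rpower x (- e)); [|lra].
    apply L2; intros z [y [Hy ->]]; now apply cross.
  + assert (F x - K * Rpower x (- e) <= L); [|lra].
    apply L1; exists x; split; auto.
Qed.

Lemma is_lim_of_rate (F : R -> R) (L K e : R) : 0 < e ->
  (forall x, 0 < x -> Rabs (F x - L) <= K * Rpower x (- e)) ->
  is_lim F p_infty L.
Proof.
intros He H.
assert (Z : is_lim (fun x => K * Rpower x (- e)) p_infty 0).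
{ replace (Finite 0) with (Rbar_mult K 0) by (simpl; f_equal; ring).
  apply is_lim_scal_l; now apply Rpower_lim_infty. }
apply (is_lim_le_le_loc (fun x => L - K * Rpower x (- e)) (fun x => L + K * Rpower x (- e))).
- exists 0; intros x Hx; assert (B := H x Hx); apply Rabs_le_between in B; lra.
- replace (Finite L) with (Finite (L - 0)) by (f_equal; ring).
  apply is_lim_minus'; [apply is_lim_const|exact Z].
- replace (Finite L) with (Finite (L + 0)) by (f_equal; ring).
  apply is_lim_plus'; [apply is_lim_const|exact Z].
Qed.

Lemma is_lim_mult_R (f g : R -> R) (x : Rbar) (l m : R) :
  is_lim f x l -> is_lim g x m -> is_lim (fun t => f t * g t) x (l * m).
Proof. intros Hf Hg; now apply (is_lim_mult f g x l m). Qed.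

Lemma ln_gt0 (x : R) : 1 < x -> 0 < ln x.
Proof. intros Hx; rewrite -ln_1; apply ln_increasing; lra. Qed.

Lemma is_lim_const_over_ln (k : R) : is_lim (fun x => k / ln x) p_infty 0.
Proof.
replace (Finite 0) with (Rbar_mult k (Rbar_inv p_infty)) by (simpl; f_equal; ring).
apply (is_lim_scal_l (fun x => / ln x)).
apply is_lim_inv; [exact is_lim_ln_p|discriminate].
Qed.

(** The denominator g may vanish: [/ 0 = 0] makes f / g = (f / s) / (g / s)
    there too, and this happens only for small x since l <> 0. *)
Lemma equiv_of_common_scale (f g s : R -> R) (l : R) : l <> 0 ->
  (forall x, 1 < x -> s x <> 0) ->
  is_lim (fun x => f x / s x) p_infty l -> is_lim (fun x => g x / s x) p_infty l ->
  is_lim (fun x => f x / g x) p_infty 1.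
Proof.
intros Hl Hs Hf Hg.
apply is_lim_ext_loc with (fun x => (f x / s x) / (g x / s x)).
- exists 1; intros x Hx; assert (S := Hs x Hx).
  unfold Rdiv; rewrite Rinv_mult Rinv_inv.
  transitivity (f x * / g x * (/ s x * s x)); [ring|].
  rewrite Rinv_l //; ring.
- replace (Finite 1) with (Rbar_div l l) by (simpl; f_equal; field; auto).
  apply is_lim_div; auto; [intros E; injection E; auto|].
  by simpl.
Qed.

(** * Averages of entire power series *)

(** Equivalent to an infinite radius of convergence, but stated with bounded
    terms so that it passes at once to any dominated sequence of coefficients. *)
Definition entire (f : nat -> R) : Prop :=
  forall r, exists M, forall m, Rabs (f m * r ^ m) <= M.

Lemma entire_CV_radius (f : nat -> R) : entire f -> CV_radius f = p_infty.
Proof.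
intros Hf; destruct (CV_radius_bounded f) as [ub _].
destruct (CV_radius f) as [r| |] eqn:E; auto.
- destruct (Hf (r + 1)) as [M HM].
  assert (H : Rbar_le (r + 1) r) by (apply ub; now exists M).
  simpl in H; lra.
- destruct (Hf 0) as [M HM].
  assert (H : Rbar_le 0 m_infty) by (apply ub; now exists M).
  contradiction H.
Qed.

Lemma entire_inside (f : nat -> R) (x : R) :
  entire f -> Rbar_lt (Rabs x) (CV_radius f).
Proof. intros Hf; now rewrite (entire_CV_radius f Hf). Qed.

Lemma entire_dominated (f g : nat -> R) :
  (forall m, Rabs (g m) <= Rabs (f m)) -> entire f -> entire g.
Proof.
intros H Hf r; destruct (Hf r) as [M HM]; exists M; intros m.
apply Rle_trans with (2 := HM m).
rewrite !Rabs_mult; apply Rmult_le_compat_r; [apply Rabs_pos|apply H].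
Qed.

Lemma entire_continuous (f : nat -> R) (x : R) :
  entire f -> continuous (PSeries f) x.
Proof.
intros Hf; apply continuity_pt_filterlim, PSeries_continuity; now apply entire_inside.
Qed.

(** Coefficients of a int_0^1 t^(a-1) f(t x) dt, for f given by its coefficients. *)
Definition wavg (a : R) (f : nat -> R) (m : nat) : R := a / (a + INR m) * f m.

Lemma wavg_weight_bound (a : R) (m : nat) : 0 < a -> 0 < a / (a + INR m) <= 1.
Proof.
intros Ha; assert (H := pos_INR m); split.
- apply Rdiv_lt_0_compat; lra.
- apply Rmult_le_reg_r with (a + INR m); [lra|].
  replace (a / (a + INR m) * (a + INR m)) with a by (field; lra); lra.
Qed.

Lemma entire_wavg (a : R) (f : nat -> R) : 0 < a -> entire f -> entire (wavg a f).
Proof.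
intros Ha; apply entire_dominated; intros m; unfold wavg.
destruct (wavg_weight_bound a m Ha).
rewrite Rabs_mult (Rabs_right (a / _)); [|lra].
assert (P := Rabs_pos (f m)).
rewrite -{2}(Rmult_1_l (Rabs (f m))); apply Rmult_le_compat_r; lra.
Qed.

Lemma PSeries_lincomb (s t : R) (f g : nat -> R) (x : R) :
  entire f -> entire g ->
  PSeries (fun m => s * f m + t * g m) x = s * PSeries f x + t * PSeries g x.
Proof.
intros Hf Hg.
rewrite -(PSeries_scal s f) -(PSeries_scal t g) -PSeries_plus.
- apply PSeries_ext; intros m; reflexivity.
- apply (ex_pseries_scal (V := R_NormedModule)); [apply Rmult_comm|].
  apply CV_radius_inside; now apply entire_inside.
- apply (ex_pseries_scal (V := R_NormedModule)); [apply Rmult_comm|].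
  apply CV_radius_inside; now apply entire_inside.
Qed.

Lemma entire_of_ex_pseries (f : nat -> R) : (forall x, ex_pseries f x) -> entire f.
Proof.
intros H r.
destruct (filterlim_bounded (K := R_AbsRing) (V := R_NormedModule) (fun m => f m * r ^ m)) as [M HM].
2: now exists M.
exists 0; apply ex_series_lim_0.
apply ex_series_ext with (2 := H r); intros m.
unfold scal; simpl; unfold mult; simpl; now rewrite pow_n_pow Rmult_comm.
Qed.

Lemma entire_PS_derive (f : nat -> R) : entire f -> entire (PS_derive f).
Proof.
intros Hf; apply entire_of_ex_pseries; intros x.
apply CV_radius_inside; rewrite CV_radius_derive; now apply entire_inside.
Qed.

Lemma PSeries_x_derive (f : nat -> R) (x : R) :
  x * PSeries (PS_derive f) x = PSeries (fun m => INR m * f m) x.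
Proof.
rewrite -PSeries_incr_1; apply PSeries_ext; intros [|m]; unfold PS_incr_1, PS_derive, zero; simpl;
    auto; ring.
Qed.

Lemma entire_INR_mult (f : nat -> R) : entire f -> entire (fun m => INR m * f m).
Proof.
intros Hf r; destruct (entire_PS_derive f Hf r) as [M HM].
exists (Rmax 0 (M * Rabs r)); intros [|m].
- simpl; rewrite !Rmult_0_l Rabs_R0; apply Rmax_l.
- apply Rle_trans with (2 := Rmax_r _ _).
  replace (INR m.+1 * f m.+1 * r ^ m.+1) with (PS_derive f m * r ^ m * r)
    by (unfold PS_derive; simpl; ring).
  rewrite Rabs_mult; apply Rmult_le_compat_r; [apply Rabs_pos|apply HM].
Qed.

(** The Euler operator a + x d/dx multiplies the m-th coefficient by a + m,
    so it undoes the average up to the factor a. *)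
Lemma wavg_euler (a : R) (f : nat -> R) (x : R) : 0 < a -> entire f ->
  a * PSeries (wavg a f) x + x * PSeries (PS_derive (wavg a f)) x = a * PSeries f x.
Proof.
intros Ha Hf; assert (Hw := entire_wavg a f Ha Hf).
rewrite PSeries_x_derive.
transitivity (a * PSeries (wavg a f) x + 1 * PSeries (fun m => INR m * wavg a f m) x); [ring|].
rewrite -PSeries_lincomb; [|auto|now apply entire_INR_mult].
rewrite -PSeries_scal; apply PSeries_ext; intros m.
unfold wavg, PS_scal, scal; simpl; unfold mult; simpl.
field; assert (H := pos_INR m); lra.
Qed.

(** This is how averages are used: x^a W_a f is the primitive of
    a x^(a-1) f vanishing at 0, without any integral. *)
Lemma is_derive_wavg (a : R) (f : nat -> R) (x : R) : 0 < a -> entire f -> 0 < x ->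
  is_derive (fun t => Rpower t a * PSeries (wavg a f) t) x
            (a * Rpower x (a - 1) * PSeries f x).
Proof.
intros Ha Hf Hx.
replace (a * Rpower x (a - 1) * PSeries f x) with
  (a * Rpower x (a - 1) * PSeries (wavg a f) x
   + Rpower x a * PSeries (PS_derive (wavg a f)) x).
- apply (is_derive_mult (fun t => Rpower t a) (PSeries (wavg a f))).
  + now apply is_derive_Rpower.
  + apply is_derive_PSeries, entire_inside; now apply entire_wavg.
  + intros; apply Rmult_comm.
- assert (E : Rpower x a = Rpower x (a - 1) * x).
  { transitivity (Rpower x (a - 1 + 1)); [f_equal; ring|].
    now rewrite Rpower_plus Rpower_1. }
  rewrite E.
  transitivity (Rpower x (a - 1) * (a * PSeries f x)); [|ring].
  rewrite -(wavg_euler a f) //; ring.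
Qed.

Lemma wavg_lim0 (a : R) (f : nat -> R) : 0 < a -> entire f ->
  filterlim (fun t => Rpower t a * PSeries (wavg a f) t) (at_right 0) (locally 0).
Proof.
intros Ha Hf.
replace (locally 0) with (locally (0 * PSeries (wavg a f) 0)) by (f_equal; ring).
apply (filterlim_comp_2 (G := locally 0) (H := locally (PSeries (wavg a f) 0))).
- now apply Rpower_lim0.
- intros P HP; apply filter_le_within.
  exact (entire_continuous _ 0 (entire_wavg a f Ha Hf) P HP).
- apply (filterlim_mult (K := R_AbsRing)).
Qed.

(** Compare x^a W_a f with the primitive C a / (a - th) x^(a - th) of
    a x^(a-1) C x^(-th); both vanish at 0.  A negative th is allowed and
    serves to bound remainders of power series. *)
Lemma wavg_bound (a th C : R) (f : nat -> R) :
  0 < a -> th < a -> entire f ->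
  (forall t, 0 < t -> Rabs (PSeries f t) <= C * Rpower t (- th)) ->
  forall x, 0 < x -> Rabs (PSeries (wavg a f) x) <= C * (a / (a - th)) * Rpower x (- th).
Proof.
intros Ha Hth Hf Hb x Hx.
assert (key : forall s, (s = 1 \/ s = -1) ->
  0 <= C * (a / (a - th)) * Rpower x (a - th) + s * (Rpower x a * PSeries (wavg a f) x)).
{ intros s Hs.
  apply (lim0_le_of_derive_ge0
   (fun x => C * (a / (a - th)) * Rpower x (a - th) + s * (Rpower x a * PSeries (wavg a f) x))
   (fun t => C * (a / (a - th)) * ((a - th) * Rpower t (a - th - 1))
      + s * (a * Rpower t (a - 1) * PSeries f t))); auto.
  - replace (locally 0) with (locally (C * (a / (a - th)) * 0 + s * 0)) by (f_equal; ring).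
    apply (filterlim_comp_2 (G := locally (C * (a / (a - th)) * 0)) (H := locally (s * 0))).
    + apply (filterlim_comp _ _ _ (fun x => Rpower x (a - th))
        (fun z => C * (a / (a - th)) * z) _ (locally 0)).
      * apply Rpower_lim0; lra.
      * apply (filterlim_scal_r (V := R_NormedModule)).
    + apply (filterlim_comp _ _ _ (fun x => Rpower x a * PSeries (wavg a f) x)
        (fun z => s * z) _ (locally 0)).
      * now apply wavg_lim0.
      * apply (filterlim_scal_r (V := R_NormedModule)).
    + apply (filterlim_plus (V := R_NormedModule)).
  - intros t Ht.
    apply (is_derive_plus (V := R_NormedModule) (fun x => C * (a / (a - th)) * Rpower x (a - th))
      (fun x => s * (Rpower x a * PSeries (wavg a f) x))).
    + apply (is_derive_scal (fun x => Rpower x (a - th))); now apply is_derive_Rpower.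
    + apply (is_derive_scal (fun x => Rpower x a * PSeries (wavg a f) x)); now apply is_derive_wavg.
  - intros t Ht.
    replace (C * (a / (a - th)) * ((a - th) * Rpower t (a - th - 1))
        + s * (a * Rpower t (a - 1) * PSeries f t))
      with (a * Rpower t (a - 1) * (C * Rpower t (- th) + s * PSeries f t)).
    + apply Rmult_le_pos; [apply Rmult_le_pos; [lra|apply Rlt_le, Rpower_gt0]|].
      assert (H := Hb t Ht); apply Rabs_le_between in H.
      destruct Hs as [-> | ->]; lra.
    + replace (Rpower t (a - th - 1)) with (Rpower t (a - 1) * Rpower t (- th)).
      * field; lra.
      * rewrite -Rpower_plus; f_equal; ring. }
assert (E : Rpower x (a - th) = Rpower x a * Rpower x (- th)) by (rewrite -Rpower_plus; f_equal; ring).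
assert (P := Rpower_gt0 x a).
assert (K1 := key 1 (or_introl (Logic.eq_refl 1))); assert (K2 := key (-1) (or_intror
    (Logic.eq_refl (-1)))).
rewrite E in K1, K2.
apply Rabs_le_between; split; apply Rmult_le_reg_l with (Rpower x a); auto; lra.
Qed.

(** Integration by parts in the average of a derivative. *)
Lemma wavg_derive_shift (a : R) (f : nat -> R) (x : R) : 0 < a -> entire f ->
  x * PSeries (wavg (a + 1) (PS_derive f)) x
  = (a + 1) * (PSeries f x - PSeries (wavg a f) x).
Proof.
intros Ha Hf; assert (Hw := entire_wavg a f Ha Hf).
transitivity ((a + 1) * PSeries f x + - (a + 1) * PSeries (wavg a f) x); [|ring].
rewrite -PSeries_lincomb // -PSeries_incr_1.
apply PSeries_ext; intros [|m]; unfold PS_incr_1, wavg, PS_derive, zero.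
- simpl; field; lra.
- rewrite S_INR; assert (H := pos_INR m); field; lra.
Qed.

(** The case a = 0 of the preceding identity, where the average W_0 f
    degenerates to evaluation at 0. *)
Lemma wavg1_derive (f : nat -> R) (x : R) : entire f ->
  x * PSeries (wavg 1 (PS_derive f)) x = PSeries f x - f O.
Proof.
intros Hf.
rewrite -PSeries_incr_1 (PSeries_decr_1 f); [|apply CV_radius_inside; now apply entire_inside].
rewrite PSeries_incr_1.
replace (f O + x * PSeries (PS_decr_1 f) x - f O) with (x * PSeries (PS_decr_1 f) x) by ring.
f_equal; apply PSeries_ext; intros m; unfold wavg, PS_derive, PS_decr_1.
rewrite S_INR; assert (H := pos_INR m); field; lra.
Qed.

(** Partial fractions:
    1 / ((m + 1) (m + a)) = (1 / (m + 1) - 1 / (m + a)) / (a - 1). *)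
Lemma wavg1_wavg (a : R) (f : nat -> R) (x : R) : 0 < a -> a <> 1 -> entire f ->
  PSeries (wavg 1 (wavg a f)) x
  = a / (a - 1) * PSeries (wavg 1 f) x + - (1 / (a - 1)) * PSeries (wavg a f) x.
Proof.
intros Ha Ha1 Hf.
rewrite -PSeries_lincomb; try apply entire_wavg; auto; try lra.
apply PSeries_ext; intros m; unfold wavg; assert (H := pos_INR m); field; lra.
Qed.

(** * Normalized Bessel functions *)

Definition expneg (m : nat) : R := (-1) ^ m / INR (Factorial.fact m).

Lemma is_pseries_expneg (x : R) : is_pseries expneg x (exp (- x)).
Proof.
apply is_series_ext with (2 := is_exp_Reals (- x)); intros m; unfold expneg, scal; simpl; unfold
    mult; simpl.
rewrite !pow_n_pow.
replace (- x) with (-1 * x) by ring. rewrite Rpow_mult_distr; unfold Rdiv; ring.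
Qed.

Lemma entire_expneg : entire expneg.
Proof. apply entire_of_ex_pseries; intros x; exists (exp (- x)); apply is_pseries_expneg. Qed.

Lemma PSeries_expneg (x : R) : PSeries expneg x = exp (- x).
Proof. apply is_pseries_unique, is_pseries_expneg. Qed.

Lemma expneg_derive (m : nat) : PS_derive expneg m = - expneg m.
Proof.
unfold PS_derive, expneg; rewrite fact_simpl mult_INR S_INR; simpl pow.
assert (F := INR_fact_lt_0 m); assert (H := pos_INR m); field; lra.
Qed.

Lemma pochhammer_gt0 (c : R) (m : nat) : 0 < c -> 0 < pochhammer c m.
Proof.
intros Hc; induction m as [|m IH]; simpl; [lra|].
apply Rmult_lt_0_compat; auto; assert (H := pos_INR m); lra.
Qed.

Lemma pochhammer_shift (c : R) (m : nat) :
  pochhammer c m.+1 = c * pochhammer (c + 1) m.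
Proof.
induction m as [|m IH]; [simpl; ring|].
change (pochhammer c m.+1 * (c + INR m.+1) = c * (pochhammer (c + 1) m * (c + 1 + INR m))).
rewrite IH S_INR; ring.
Qed.

Lemma pochhammer_ge1 (c : R) (m : nat) : 1 <= c -> 1 <= pochhammer c m.
Proof.
intros Hc; induction m as [|m IH]; simpl; [lra|].
assert (H := pos_INR m).
rewrite -{1}(Rmult_1_l 1); apply Rmult_le_compat; lra.
Qed.

(** Coefficients of 0F1(; c; -x), that is of
    Gamma(c) x^((1-c)/2) J_(c-1)(2 sqrt x). *)
Definition bessel_coef (c : R) (m : nat) : R :=
  (-1) ^ m / (INR (Factorial.fact m) * pochhammer c m).

Lemma entire_bessel (c : R) : 0 < c -> entire (bessel_coef c).
Proof.
intros Hc.
assert (M : 0 < Rmin 1 c) by (apply Rmin_glb_lt; lra).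
apply entire_dominated with (fun m => / Rmin 1 c * expneg m).
- intros m; unfold bessel_coef, expneg; assert (F := INR_fact_lt_0 m).
  assert (P := pochhammer_gt0 c m Hc).
  assert (B : Rmin 1 c <= pochhammer c m).
  { destruct m as [|m]; [apply Rmin_l|].
    rewrite pochhammer_shift; apply Rle_trans with (1 := Rmin_r 1 c).
    assert (H := pochhammer_ge1 (c + 1) m ltac:(lra)).
    rewrite -{1}(Rmult_1_r c); apply Rmult_le_compat_l; lra. }
  unfold Rdiv; rewrite !Rabs_mult pow_1_abs !Rabs_inv Rabs_mult.
  rewrite !Rabs_right; try lra.
  rewrite Rinv_mult.
  assert (I := Rinv_le_contravar _ _ M B).
  assert (I2 := Rinv_0_lt_compat _ F).
  rewrite !Rmult_1_l Rmult_comm; apply Rmult_le_compat_r; lra.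
- intros r; destruct (entire_expneg r) as [K HK]; exists (/ Rmin 1 c * K); intros m.
  rewrite Rmult_assoc Rabs_mult Rabs_right; [|apply Rle_ge, Rlt_le, Rinv_0_lt_compat, M].
  apply Rmult_le_compat_l; auto; apply Rlt_le, Rinv_0_lt_compat, M.
Qed.

Lemma bessel_derive (c : R) (m : nat) : 0 < c ->
  PS_derive (bessel_coef c) m = - / c * bessel_coef (c + 1) m.
Proof.
intros Hc; unfold PS_derive, bessel_coef; rewrite pochhammer_shift fact_simpl mult_INR.
assert (P := pochhammer_gt0 (c + 1) m ltac:(lra)).
assert (F := INR_fact_lt_0 m); assert (H := pos_INR m).
rewrite S_INR; simpl pow; field; lra.
Qed.

(** Averaging with a = c is the step from c to c + 1, since
    (c)_m (c + m) = c (c + 1)_m. *)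
Lemma wavg_bessel (c : R) (m : nat) : 0 < c ->
  wavg c (bessel_coef c) m = bessel_coef (c + 1) m.
Proof.
intros Hc; unfold wavg, bessel_coef.
assert (P := pochhammer_gt0 (c + 1) m ltac:(lra)).
assert (P' := pochhammer_gt0 c m ltac:(lra)).
assert (F := INR_fact_lt_0 m); assert (H := pos_INR m).
assert (E : pochhammer c m * (c + INR m) = c * pochhammer (c + 1) m) by exact (pochhammer_shift c m).
replace (pochhammer (c + 1) m) with (pochhammer c m * (c + INR m) / c).
- field; lra.
- rewrite E; field; lra.
Qed.

Definition phi (c x : R) : R := PSeries (bessel_coef c) x.

Lemma PSeries_bessel_derive (c x : R) : 0 < c ->
  PSeries (PS_derive (bessel_coef c)) x = - / c * phi (c + 1) x.
Proof.
intros Hc; unfold phi; rewrite -PSeries_scal.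
apply PSeries_ext; intros m; now apply bessel_derive.
Qed.

Lemma is_derive_phi (c x : R) : 0 < c -> is_derive (phi c) x (- / c * phi (c + 1) x).
Proof.
intros Hc; rewrite -PSeries_bessel_derive //.
now apply is_derive_PSeries, entire_inside, entire_bessel.
Qed.

Lemma phi_0 (c : R) : phi c 0 = 1.
Proof. unfold phi; rewrite PSeries_0; unfold bessel_coef; simpl; field. Qed.

(** By [wavg_euler] and [wavg_bessel], x phi_(c+1)' = c (phi_c - phi_(c+1)).
    With phi_c' = - phi_(c+1) / c, the derivative of the left-hand side is
    (1 - 2 c) phi_(c+1)^2 / c^2 <= 0; the value at 0 is 1. *)
Lemma phi_energy (c x : R) : / 2 <= c -> 0 <= x ->
  (phi c x) ^ 2 + x * (phi (c + 1) x) ^ 2 / c ^ 2 <= 1.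
Proof.
intros Hc Hx.
set (psi := phi (c + 1)); set (dpsi := fun t => - / (c + 1) * phi (c + 1 + 1) t).
assert (H : - (phi c 0 ^ 2 + 0 * psi 0 ^ 2 / c ^ 2) <= - (phi c x ^ 2 + x * psi x ^ 2 / c ^ 2)).
2: { rewrite phi_0 in H; unfold psi in *; lra. }
apply (nondecreasing_of_derive_ge0 (fun x => - (phi c x ^ 2 + x * psi x ^ 2 / c ^ 2))
  (fun t => - (2 * phi c t * (- / c * psi t) + (psi t ^ 2 + t * (2 * psi t * dpsi t)) / c ^ 2))); auto.
- intros t Ht.
  assert (D1 := is_derive_phi c t ltac:(lra)).
  assert (D2 := is_derive_phi (c + 1) t ltac:(lra)).
  fold psi in D1, D2. fold (dpsi t) in D2.
  auto_derive.
  + split; [eexists; exact D1|split; auto; eexists; exact D2].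
  + rewrite (is_derive_unique (fun x => phi c x) t _ D1) (is_derive_unique
      (fun x => psi x) t _ D2); field; lra.
- intros t Ht.
  assert (E : t * dpsi t = c * (phi c t - psi t)).
  { assert (W := wavg_euler c (bessel_coef c) t ltac:(lra) ltac:(apply entire_bessel; lra)).
    rewrite (PSeries_ext _ (bessel_coef (c + 1))) in W; [|intros; apply wavg_bessel; lra].
    rewrite (PSeries_ext (PS_derive (wavg c (bessel_coef c))) (PS_derive (bessel_coef (c + 1)))) in W.
    2: { intros m; unfold PS_derive; rewrite wavg_bessel //; lra. }
    rewrite PSeries_bessel_derive in W; [|lra].
    fold (phi (c + 1) t) (phi c t) in W; fold psi in W; fold (dpsi t) in W. lra. }
  replace (t * (2 * psi t * dpsi t)) with (2 * psi t * (t * dpsi t)) by ring.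
  rewrite E.
  replace (- _) with ((2 * c - 1) * (psi t) ^ 2 * (/ c) ^ 2) by (field; lra).
  apply Rmult_le_pos; [apply Rmult_le_pos; [lra|]|]; apply pow2_ge_0.
Qed.

Lemma phi_le1 (c x : R) : / 2 <= c -> 0 <= x -> Rabs (phi c x) <= 1.
Proof.
intros Hc Hx; assert (E := phi_energy c x Hc Hx).
assert (0 <= x * phi (c + 1) x ^ 2 / c ^ 2).
{ apply Rmult_le_pos; [apply Rmult_le_pos; [lra|apply pow2_ge_0]|].
  apply Rlt_le, Rinv_0_lt_compat, pow_lt; lra. }
apply Rabs_le_between; split; nra.
Qed.

Lemma phi_decay_half (c x : R) : 3 / 2 <= c -> 0 < x ->
  Rabs (phi c x) <= (c - 1) * Rpower x (- / 2).
Proof.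
intros Hc Hx; assert (E := phi_energy (c - 1) x ltac:(lra) ltac:(lra)).
replace (c - 1 + 1) with c in E by ring.
rewrite Rpower_Ropp Rpower_sqrt //.
assert (S := sqrt_lt_R0 x Hx).
assert (E2 : x * phi c x ^ 2 / (c - 1) ^ 2 <= 1) by (assert (P := pow2_ge_0 (phi (c - 1) x)); lra).
apply Rabs_le_between.
assert (Q : (sqrt x * phi c x) ^ 2 <= (c - 1) ^ 2).
{ rewrite Rpow_mult_distr pow2_sqrt; [|lra].
  apply Rmult_le_reg_r with (/ (c - 1) ^ 2).
  - apply Rinv_0_lt_compat, pow_lt; lra.
  - rewrite Rinv_r; [exact E2|]; apply pow_nonzero; lra. }
assert (Q2 : - (c - 1) <= sqrt x * phi c x <= c - 1) by nra.
split; apply Rmult_le_reg_l with (sqrt x); auto.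
- replace (sqrt x * - ((c - 1) * / sqrt x)) with (- (c - 1)) by (field; lra); lra.
- replace (sqrt x * ((c - 1) * / sqrt x)) with (c - 1) by (field; lra); lra.
Qed.

(** Interpolates between |phi_c| <= 1 and the decay in x^(-1/2), to leave a
    choice of exponent when the averaging parameter a is small. *)
Lemma phi_decay (c th x : R) : 3 / 2 <= c -> 0 <= th <= / 2 -> 0 < x ->
  Rabs (phi c x) <= c * Rpower x (- th).
Proof.
intros Hc Hth Hx.
assert (P := Rpower_gt0 x (- th)).
destruct (Rle_dec x 1) as [H|H].
- apply Rle_trans with (1 := phi_le1 c x ltac:(lra) ltac:(lra)).
  assert (1 <= Rpower x (- th)); [|nra].
  unfold Rpower; rewrite -{1}exp_0.
  assert (ln x <= 0).
  { destruct H as [H| ->]; [|rewrite ln_1; lra].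
    apply Rlt_le; rewrite -ln_1; apply ln_increasing; lra. }
  assert (L : 0 <= - th * ln x) by nra.
  destruct L as [L|<-]; [apply Rlt_le, exp_increasing|]; lra.
- apply Rle_trans with (1 := phi_decay_half c x Hc Hx).
  assert (Q : Rpower x (- / 2) <= Rpower x (- th)) by (apply Rle_Rpower; lra).
  assert (P2 := Rpower_gt0 x (- / 2)); nra.
Qed.

Definition drop_terms (k : nat) (f : nat -> R) (m : nat) : R := if (m < k)%nat then 0 else f m.

Lemma entire_drop_terms (k : nat) (f : nat -> R) : entire f -> entire (drop_terms k f).
Proof.
apply entire_dominated; intros m; unfold drop_terms; case: ifP => _; [|lra].
rewrite Rabs_R0; apply Rabs_pos.
Qed.

Lemma PSeries_drop_terms (k : nat) (f : nat -> R) (x : R) : entire f ->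
  PSeries f x = sum_f_R0 (fun m => f m * x ^ m) k + PSeries (drop_terms k.+1 f) x.
Proof.
intros Hf.
assert (ex : forall g, entire g -> ex_series (fun m => g m * x ^ m)).
{ intros g Hg; apply ex_series_Rabs, CV_disk_inside; now apply entire_inside. }
unfold PSeries.
rewrite (Series_incr_n (fun m => f m * x ^ m) k.+1); [|lia|now apply ex].
rewrite (Series_incr_n (fun m => drop_terms k.+1 f m
    * x ^ m) k.+1); [|lia|now apply ex, entire_drop_terms].
simpl Init.Nat.pred.
rewrite (sum_eq_R0 (fun m => drop_terms k.+1 f m * x ^ m)).
- rewrite Rplus_0_l; f_equal; apply Series_ext; intros m; unfold drop_terms.
  case: ifP => // /ltP; lia.
- intros m Hm; unfold drop_terms; case: ifP; [intros _; ring|].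
  move=> /ltP; lia.
Qed.

(** As for exp(-x): the remainder after k terms differentiates to - 1 / c
    times that after k - 1 terms for c + 1, and the induction starts from |phi_c| <= 1. *)
Lemma phi_envelope (k : nat) (c x : R) : / 2 <= c -> 0 <= x ->
  Rabs (PSeries (drop_terms k (bessel_coef c)) x) <= Rabs (bessel_coef c k) * x ^ k.
Proof.
revert c x; induction k as [|k IH]; intros c x Hc Hx.
- rewrite (PSeries_ext _ (bessel_coef c)); [|reflexivity].
  unfold bessel_coef at 2; simpl; rewrite Rmult_1_l Rdiv_diag; [|lra].
  rewrite Rabs_R1 Rmult_1_l; now apply phi_le1.
- assert (He := entire_drop_terms k.+1 _ (entire_bessel c ltac:(lra))).
  assert (D : forall t, PSeries (PS_derive (drop_terms k.+1 (bessel_coef c))) t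
     = - / c * PSeries (drop_terms k (bessel_coef (c + 1))) t).
  { intros t; rewrite -PSeries_scal; apply PSeries_ext; intros m.
    unfold PS_scal, scal; simpl; unfold mult; simpl.
    unfold PS_derive, drop_terms; rewrite ltnS; case: ifP => _; [ring|].
    apply bessel_derive; lra. }
  assert (B : INR k.+1 * Rabs (bessel_coef c k.+1) = / c * Rabs (bessel_coef (c + 1) k)).
  { rewrite -(Rabs_right (INR k.+1)); [|apply Rle_ge, pos_INR].
    rewrite -Rabs_mult; change (Rabs (PS_derive (bessel_coef c) k) = / c * Rabs (bessel_coef (c + 1) k)).
    rewrite bessel_derive ?Rabs_mult ?Rabs_Ropp ?(Rabs_right (/ c)) //; [|lra].
    apply Rle_ge, Rlt_le, Rinv_0_lt_compat; lra. }
  assert (key : forall s, (s = 1 \/ s = -1) ->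
    0 <= Rabs (bessel_coef c k.+1) * x ^ k.+1 + s * PSeries (drop_terms k.+1 (bessel_coef c)) x).
  { intros s Hs.
    apply Rle_trans with (Rabs (bessel_coef c k.+1) * 0 ^ k.+1
        + s * PSeries (drop_terms k.+1 (bessel_coef c)) 0).
    { rewrite PSeries_0; unfold drop_terms; simpl; lra. }
    apply (nondecreasing_of_derive_ge0
      (fun x => Rabs (bessel_coef c k.+1) * x ^ k.+1 + s * PSeries (drop_terms k.+1 (bessel_coef c)) x)
      (fun t => Rabs (bessel_coef c k.+1) * (INR k.+1 * t ^ k)
          + s * (- / c * PSeries (drop_terms k (bessel_coef (c + 1))) t))); auto.
    - intros t Ht.
      apply (is_derive_plus (V := R_NormedModule) (fun x => Rabs (bessel_coef c k.+1) * x ^ k.+1)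
        (fun x => s * PSeries (drop_terms k.+1 (bessel_coef c)) x)).
      + apply (is_derive_scal (fun x => x ^ k.+1)). 
        apply is_derive_Reals, derivable_pt_lim_pow.
      + apply (is_derive_scal (PSeries (drop_terms k.+1 (bessel_coef c)))).
        rewrite -D; now apply is_derive_PSeries, entire_inside.
    - intros t Ht; assert (I := IH (c + 1) t ltac:(lra) ltac:(lra)).
      replace (Rabs (bessel_coef c k.+1) * (INR k.+1 * t ^ k))
          with (INR k.+1 * Rabs (bessel_coef c k.+1) * t ^ k) by ring.
      rewrite B.
      apply Rabs_le_between in I.
      assert (C := Rinv_0_lt_compat c ltac:(lra)).
      destruct Hs as [-> | ->]; nra. }
  assert (K1 := key 1 (or_introl (Logic.eq_refl 1))); assert (K2 := key (-1) (or_intror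
      (Logic.eq_refl (-1)))).
  apply Rabs_le_between; lra.
Qed.

(** Dropping the first terms of a series commutes with averaging, so
    [wavg_bound] applies to the remainder with th = - (k + 1). *)
Lemma wavg_phi_envelope (k : nat) (a c x : R) : 0 < a -> / 2 <= c -> 0 < x ->
  Rabs (PSeries (wavg a (bessel_coef c)) x - sum_f_R0 (fun m => wavg a (bessel_coef c) m * x ^ m) k)
  <= Rabs (bessel_coef c k.+1) * x ^ k.+1.
Proof.
intros Ha Hc Hx.
assert (Hb := entire_bessel c ltac:(lra)).
rewrite (PSeries_drop_terms k); [|now apply entire_wavg].
replace (_ + _ - _) with (PSeries (drop_terms k.+1 (wavg a (bessel_coef c))) x) by ring.
rewrite (PSeries_ext _ (wavg a (drop_terms k.+1 (bessel_coef c)))).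
2: { intros m; unfold drop_terms, wavg; case: ifP => _; ring. }
assert (P := pos_INR k.+1).
assert (W := wavg_bound a (- INR k.+1) (Rabs (bessel_coef c k.+1)) (drop_terms k.+1 (bessel_coef
    c)) Ha ltac:(lra) (entire_drop_terms _ _ Hb)).
rewrite Ropp_involutive in W.
apply Rle_trans with (1 := W ltac:(intros t Ht; rewrite Rpower_pow //; apply phi_envelope; lra) x Hx).
rewrite Rpower_pow //.
apply Rmult_le_compat_r; [apply pow_le; lra|].
rewrite -{2}(Rmult_1_r (Rabs (bessel_coef c k.+1))); apply Rmult_le_compat_l; [apply Rabs_pos|].
replace (a - - INR k.+1) with (a + INR k.+1) by ring.
now apply wavg_weight_bound.
Qed.

(** * The Gamma function *)

Definition gamma_density (s t : R) : R := Rpower t (s - 1) * exp (- t).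

Lemma gamma_density_mul (s e t : R) :
  gamma_density (s + e) t = Rpower t e * gamma_density s t.
Proof.
unfold gamma_density; rewrite -Rmult_assoc -Rpower_plus.
f_equal; f_equal; ring.
Qed.

Lemma gamma_density_gt0 (s t : R) : 0 < gamma_density s t.
Proof. apply Rmult_lt_0_compat; [apply Rpower_gt0|apply exp_pos]. Qed.

(** The maximum of t^q e^(-t) is (q/e)^q; the bound q^q comes from
    ln y <= y at y = t / q. *)
Lemma Rpower_exp_bound (q t : R) : 0 < q -> 0 < t ->
  Rpower t q * exp (- t) <= Rpower q q.
Proof.
intros Hq Ht; unfold Rpower; rewrite -exp_plus.
assert (H : q * ln t + - t <= q * ln q).
{ assert (E := exp_ineq1_le (ln (t / q))).
  rewrite exp_ln in E; [|now apply Rdiv_lt_0_compat].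
  rewrite ln_div // in E.
  apply Rmult_le_compat_r with (r := q) in E; [|lra].
  replace (t / q * q) with t in E by (field; lra); lra. }
destruct H as [H| ->]; [apply Rlt_le, exp_increasing|]; lra.
Qed.

Lemma Rpower_exp_lim (s : R) : 0 < s ->
  is_lim (fun x => Rpower x s * exp (- x)) p_infty 0.
Proof.
intros Hs; apply is_lim_of_rate with (Rpower (s + 1) (s + 1)) 1; [lra|].
intros x Hx; assert (B := Rpower_exp_bound (s + 1) x ltac:(lra) Hx).
rewrite Rminus_0_r Rabs_right; [|apply Rle_ge, Rlt_le, Rmult_lt_0_compat; [apply Rpower_gt0|apply
    exp_pos]].
replace (Rpower x s) with (Rpower x (s + 1) * Rpower x (- (1))) by (rewrite -Rpower_plus; f_equal; ring).
assert (P := Rpower_gt0 x (- (1))); nra.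
Qed.

Lemma is_derive_gamma_primitive (s x : R) : 0 < s -> 0 < x ->
  is_derive (fun t => Rpower t s * PSeries (wavg s expneg) t) x (s * gamma_density s x).
Proof.
intros Hs Hx; unfold gamma_density; rewrite -PSeries_expneg -Rmult_assoc.
apply is_derive_wavg; auto; apply entire_expneg.
Qed.

Lemma continuous_gamma_density (s x : R) : 0 < x -> continuous (gamma_density s) x.
Proof.
intros Hx; apply: ex_derive_continuous; unfold gamma_density.
apply (ex_derive_mult (fun t => Rpower t (s - 1)) (fun t => exp (- t))).
- eexists; now apply is_derive_Rpower.
- auto_derive; auto.
Qed.

Lemma near_0_infty (P : R -> R -> Prop) :
  (forall x y, 0 < x < 1 -> 1 < y -> P x y) ->
  filter_prod (at_right 0) (Rbar_locally p_infty) (fun ab => P (fst ab) (snd ab)).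
Proof.
intros H.
apply Filter_prod with (fun x => 0 < x < 1) (fun y => 1 < y); auto.
- exists (mkposreal 1 Rlt_0_1); intros y Hy Hy0.
  unfold ball in Hy; simpl in Hy; unfold AbsRing_ball, abs, minus, plus, opp in Hy; simpl in Hy.
  apply Rabs_def2 in Hy; lra.
- now exists 1.
Qed.

(** x^s W_s exp(-x) / s is a primitive of t^(s-1) e^(-t) that vanishes at 0,
    and it converges at infinity since t^(s-1) e^(-t) <= K t^(-2).  So Euler's
    integral converges, and it is computed by the average of exp(-x). *)
Lemma gamma_primitive (s : R) : 0 < s ->
  is_RInt_gen (gamma_density s) (at_right 0) (Rbar_locally p_infty) (Gamma s) /\
  is_lim (fun x => Rpower x s * PSeries (wavg s expneg) x) p_infty (s * Gamma s).
Proof.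
intros Hs.
set (F := fun x => Rpower x s * PSeries (wavg s expneg) x).
destruct (limit_of_derive_bound F
    (fun x => s * gamma_density s x) (s * Rpower (s + 1) (s + 1)) 1) as [L HL].
- lra.
- intros t Ht; now apply is_derive_gamma_primitive.
- intros t Ht; assert (G := gamma_density_gt0 s t).
  rewrite Rabs_right; [|apply Rle_ge, Rlt_le, Rmult_lt_0_compat; auto].
  rewrite Rmult_1_r Rmult_assoc; apply Rmult_le_compat_l; [lra|].
  assert (B := Rpower_exp_bound (s + 1) t ltac:(lra) Ht).
  unfold gamma_density.
  replace (Rpower t (s - 1))
      with (Rpower t (s + 1) * Rpower t (- (1) - 1)) by (rewrite -Rpower_plus; f_equal; ring).
  assert (P := Rpower_gt0 t (- (1) - 1)); nra.
- assert (lim : is_lim F p_infty L) by (apply is_lim_of_rate with (2 := HL); lra).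
  assert (D : forall t, 0 < t -> is_derive (fun x => / s * F x) t (gamma_density s t)).
  { intros t Ht; replace (gamma_density s t) with (/ s * (s * gamma_density s t)) by (field; lra).
    apply (is_derive_scal F); now apply is_derive_gamma_primitive. }
  assert (I : is_RInt_gen (gamma_density s) (at_right 0) (Rbar_locally p_infty) (/ s * L - / s * 0)).
  { apply is_RInt_gen_ext with (Derive (fun x => / s * F x)).
    - apply (near_0_infty (fun a b => forall x, Rmin a b < x < Rmax a b -> Derive
        (fun x => / s * F x) x = gamma_density s x)).
      intros x y Hx Hy t; rewrite Rmin_left ?Rmax_right; [|lra|lra]; intros Ht.
      apply is_derive_unique, D; lra.
    - apply is_RInt_gen_Derive.
      + apply (near_0_infty (fun a b => forall x, Rmin a b <= x <= Rmax a b -> ex_derive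
          (fun x => / s * F x) x)).
        intros x y Hx Hy t; rewrite Rmin_left ?Rmax_right; [|lra|lra]; intros Ht.
        eexists; apply D; lra.
      + apply (near_0_infty (fun a b => forall x, Rmin a b <= x <= Rmax a b -> continuous (Derive
          (fun x => / s * F x)) x)).
        intros x y Hx Hy t; rewrite Rmin_left ?Rmax_right; [|lra|lra]; intros Ht.
        apply continuous_ext_loc with (gamma_density s).
        * exists (mkposreal t ltac:(lra)); intros z Hz.
          unfold ball in Hz; simpl in Hz; unfold AbsRing_ball, abs, minus, plus, opp in Hz; simpl in Hz.
          apply Rabs_def2 in Hz; symmetry; apply is_derive_unique, D; lra.
        * apply continuous_gamma_density; lra.
      + apply (filterlim_comp _ _ _ F (fun z => / s * z) _ (locally 0)).
        * apply wavg_lim0; auto; apply entire_expneg.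
        * apply (filterlim_scal_r (V := R_NormedModule)).
      + apply (filterlim_comp _ _ _ F (fun z => / s * z) _ (locally L)).
        * exact lim.
        * apply (filterlim_scal_r (V := R_NormedModule)). }
  assert (E : Gamma s = / s * L - / s * 0).
  { apply (is_RInt_gen_unique (gamma_density s)); exact I. }
  split; rewrite E; [exact I|].
  replace (s * (/ s * L - / s * 0)) with L by (field; lra); exact lim.
Qed.

(** Integration by parts, in the form of [wavg_derive_shift] for exp(-x). *)
Lemma Gamma_succ (s : R) : 0 < s -> Gamma (s + 1) = s * Gamma s.
Proof.
intros Hs; destruct (gamma_primitive s Hs) as [_ L1].
destruct (gamma_primitive (s + 1) ltac:(lra)) as [_ L2].
assert (L3 : is_lim (fun x => Rpower x (s + 1) * PSeries (wavg (s + 1) expneg) x) p_infty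
   ((s + 1) * (s * Gamma s - 0))).
{ apply is_lim_ext_loc with
   (fun x => (s + 1) * (Rpower x s * PSeries (wavg s expneg) x - Rpower x s * exp (- x))).
  - exists 0; intros x Hx.
    assert (W := wavg_derive_shift s expneg x Hs entire_expneg).
    rewrite PSeries_expneg (PSeries_ext _ (PS_scal (-1) (wavg (s + 1) expneg))) in W.
    2: { intros m; change (wavg (s + 1) (PS_derive expneg) m = -1 * wavg (s + 1) expneg m).
         unfold wavg; rewrite expneg_derive; ring. }
    rewrite PSeries_scal in W.
    rewrite Rpower_plus Rpower_1 //.
    transitivity (Rpower x s * (- (x * (-1 * PSeries (wavg (s + 1) expneg) x)))); [rewrite W|]; ring.
  - apply (is_lim_scal_l _ (s + 1) p_infty (s * Gamma s - 0)).
    apply is_lim_minus'; auto; now apply Rpower_exp_lim. }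
assert (E := is_lim_unique _ _ _ L2); rewrite (is_lim_unique _ _ _ L3) in E.
injection E; intros E2; apply Rmult_eq_reg_l with (s + 1); lra.
Qed.

Lemma Gamma_gt0 (s : R) : 0 < s -> 0 < Gamma s.
Proof.
intros Hs; destruct (gamma_primitive s Hs) as [_ L].
set (F := fun x => Rpower x s * PSeries (wavg s expneg) x) in L.
assert (D : forall t, 0 < t -> is_derive F t (s * gamma_density s t)).
{ intros; now apply is_derive_gamma_primitive. }
assert (P : forall t, 0 < s * gamma_density s t).
{ intros; apply Rmult_lt_0_compat; auto; apply gamma_density_gt0. }
assert (F1 : 0 <= F 1).
{ apply (lim0_le_of_derive_ge0 F (fun t => s * gamma_density s t)); auto; try lra.
  - apply wavg_lim0; auto; apply entire_expneg.
  - intros; now apply Rlt_le. }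
assert (F2 : F 1 < F 2).
{ destruct (MVT_gen F 1 2 (fun t => s * gamma_density s t)) as [t [_ E]].
  - intros t; rewrite Rmin_left; [|lra]; intros Ht; apply D; lra.
  - intros t; rewrite Rmin_left; [|lra]; intros Ht.
    apply continuity_pt_filterlim; apply: ex_derive_continuous; eexists; apply D; lra.
  - assert (Q := P t); lra. }
assert (F2L : Rbar_le (F 2) (s * Gamma s)).
{ apply (is_lim_le_loc (fun _ => F 2) F p_infty); [|apply is_lim_const|exact L].
  exists 2; intros x Hx.
  apply (nondecreasing_of_derive_ge0 F
      (fun t => s * gamma_density s t)); [|intros; now apply Rlt_le|lra].
  intros; apply D; lra. }
simpl in F2L; apply Rmult_lt_reg_l with s; lra.
Qed.

Lemma Gamma_pochhammer (c : R) (m : nat) : 0 < c -> Gamma (c + INR m) = pochhammer c m * Gamma c.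
Proof.
intros Hc; induction m as [|m IH]; [simpl; rewrite Rplus_0_r; ring|].
rewrite S_INR -Rplus_assoc Gamma_succ; [|assert (H := pos_INR m); lra].
rewrite IH; simpl; ring.
Qed.

(** * The Mellin transform of a normalized Bessel function *)

(** Since phi_c = - (c - 1) phi_(c-1)', adding
    a (c - 1) x^(a-1) phi_(c-1) to x^a W_a phi_c leaves the derivative
    a (c - 1) (a - 1) x^(a-2) phi_(c-1), which is integrable at infinity
    because |phi_(c-1)| <= 1 and a < 1. *)
Lemma wavg_phi_rate (a c : R) : 0 < a < 1 -> 3 / 2 <= c ->
  exists L, forall x, 0 < x ->
    Rabs (Rpower x a * PSeries (wavg a (bessel_coef c)) x - L) <= 2 * a * (c - 1) * Rpower x (a - 1).
Proof.
intros Ha Hc.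
destruct (limit_of_derive_bound
  (fun x => Rpower x a * PSeries (wavg a (bessel_coef c)) x
      + a * (c - 1) * (Rpower x (a - 1) * phi (c - 1) x))
  (fun x => a * (c - 1) * (a - 1) * Rpower x (a - 2) * phi (c - 1) x) (a * (c - 1)) (1 - a)) as [L HL].
- lra.
- intros t Ht.
  replace (a * (c - 1) * (a - 1) * Rpower t (a - 2) * phi (c - 1) t) with
   (a * Rpower t (a - 1) * phi c t + a * (c - 1) *
      ((a - 1) * Rpower t (a - 1 - 1) * phi (c - 1) t
          + Rpower t (a - 1) * (- / (c - 1) * phi (c - 1 + 1) t))).
  + apply (is_derive_plus (V := R_NormedModule)
      (fun x => Rpower x a * PSeries (wavg a (bessel_coef c)) x)
      (fun x => a * (c - 1) * (Rpower x (a - 1) * phi (c - 1) x))).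
    * apply is_derive_wavg; auto; try lra; apply entire_bessel; lra.
    * apply (is_derive_scal (fun x => Rpower x (a - 1) * phi (c - 1) x)).
      apply (is_derive_mult (fun x => Rpower x (a - 1)) (phi (c - 1))).
      -- now apply is_derive_Rpower.
      -- apply is_derive_phi; lra.
      -- intros; apply Rmult_comm.
  + replace (c - 1 + 1) with c by ring. replace (a - 1 - 1) with (a - 2) by ring. field; lra.
- intros t Ht; rewrite !Rabs_mult.
  rewrite (Rabs_right a) ?(Rabs_right (c - 1)) ?(Rabs_left (a - 1)) ?(Rabs_right (Rpower _ _)); try lra.
  2: apply Rle_ge, Rlt_le, Rpower_gt0.
  replace (- (1 - a) - 1) with (a - 2) by ring.
  assert (B := phi_le1 (c - 1) t ltac:(lra) ltac:(lra)).
  assert (P := Rpower_gt0 t (a - 2)).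
  assert (Q : 0 < a * (c - 1) * (1 - a)) by (apply Rmult_lt_0_compat; nra).
  replace (a * (c - 1) * - (a - 1) * Rpower t (a - 2) * Rabs (phi (c - 1) t))
    with ((a * (c - 1) * (1 - a) * Rpower t (a - 2)) * Rabs (phi (c - 1) t)) by ring.
  rewrite -{2}(Rmult_1_r (a * (c - 1) * (1 - a) * Rpower t (a - 2))).
  apply Rmult_le_compat_l; auto; apply Rlt_le, Rmult_lt_0_compat; lra.
- exists L; intros x Hx; assert (H := HL x Hx).
  replace (- (1 - a)) with (a - 1) in H by ring.
  assert (B := phi_le1 (c - 1) x ltac:(lra) ltac:(lra)).
  assert (P := Rpower_gt0 x (a - 1)).
  assert (Q : 0 < a * (c - 1)) by nra.
  assert (B2 : Rabs (a * (c - 1) * (Rpower x (a - 1) * phi (c - 1) x)) <= a * (c - 1)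
      * Rpower x (a - 1)).
  { rewrite !Rabs_mult (Rabs_right a) ?(Rabs_right (c - 1)) ?(Rabs_right (Rpower _ _)); try lra.
    rewrite -Rmult_assoc -{2}(Rmult_1_r (a * (c - 1) * Rpower x (a - 1))).
    apply Rmult_le_compat_l; auto; apply Rlt_le, Rmult_lt_0_compat; lra. }
  apply Rabs_le_between in H; apply Rabs_le_between in B2; apply Rabs_le_between; lra.
Qed.

Lemma is_RInt_gen_gamma_sum (s : R) (b : nat -> R) (k : nat) : 0 < s ->
  is_RInt_gen (fun t => sum_f_R0 (fun m => b m * gamma_density (s + INR m) t) k)
    (at_right 0) (Rbar_locally p_infty)
    (sum_f_R0 (fun m => b m * Gamma (s + INR m)) k).
Proof.
intros Hs.
assert (I : forall m, is_RInt_gen (fun t => b m * gamma_density (s + INR m) t)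
   (at_right 0) (Rbar_locally p_infty) (b m * Gamma (s + INR m))).
{ intros m; apply (is_RInt_gen_scal (gamma_density (s + INR m)) (b m)).
  apply gamma_primitive; assert (H := pos_INR m); lra. }
induction k as [|k IH]; [apply I|].
apply (is_RInt_gen_plus _ _ _ _ IH (I k.+1)).
Qed.

(** The rate of convergence to L and the envelope of phi_c, both taken at the
    point x t and multiplied by the density t^(c-a-1) e^(-t). *)
Lemma gamma_average_pointwise (a c L x t : R) (k : nat) : 0 < a < 1 -> 3 / 2 <= c -> 0 < x -> 0 < t ->
  (forall y, 0 < y ->
    Rabs (Rpower y a * PSeries (wavg a (bessel_coef c)) y - L) <= 2 * a * (c - 1) * Rpower y (a - 1)) ->
  Rabs (L * gamma_density (c - a) t - Rpower x a * sum_f_R0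
      (fun m => wavg a (bessel_coef c) m * x ^ m * gamma_density (c + INR m) t) k)
    <= 2 * a * (c - 1) * Rpower x (a - 1) * gamma_density (c - 1) t
       + Rpower x a * Rabs (bessel_coef c k.+1) * x ^ k.+1 * gamma_density (c + INR k.+1) t.
Proof.
intros Ha Hc Hx Ht0 HL.
assert (Hy : 0 < x * t) by (apply Rmult_lt_0_compat; lra).
assert (G := gamma_density_gt0 c t).
assert (P := Rpower_gt0 t (- a)).
assert (Pa := Rpower_gt0 (x * t) a).
assert (S : sum_f_R0 (fun m => wavg a (bessel_coef c) m * x ^ m * gamma_density (c + INR m) t) k
   = sum_f_R0 (fun m => wavg a (bessel_coef c) m * (x * t) ^ m) k * gamma_density c t).
{ rewrite Rmult_comm scal_sum; apply sum_eq; intros m _.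
  rewrite gamma_density_mul Rpower_pow // Rpow_mult_distr; ring. }
rewrite S (gamma_density_mul c (- a)) (gamma_density_mul c (- (1))) gamma_density_mul Rpower_pow //.
assert (Ea : Rpower x a = Rpower (x * t) a * Rpower t (- a)).
{ rewrite -Rpower_mult_distr // Rmult_assoc -Rpower_plus.
  replace (a + - a) with 0 by ring. rewrite Rpower_O //; ring. }
assert (Ea1 : Rpower x (a - 1) * Rpower t (- (1)) = Rpower (x * t) (a - 1) * Rpower t (- a)).
{ rewrite -Rpower_mult_distr // Rmult_assoc -Rpower_plus; f_equal; f_equal; ring. }
set (y := x * t) in *.
set (S0 := sum_f_R0 _ k).
assert (B1 := HL y Hy).
assert (B2 := wavg_phi_envelope k a c y ltac:(lra) ltac:(lra) Hy).
fold S0 in B2; set (W := PSeries _ y) in *.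
replace (L * (Rpower t (- a) * gamma_density c t) - Rpower x a * (S0 * gamma_density c t))
  with ((Rpower t (- a) * gamma_density c t) * (L - Rpower y a * S0)) by (rewrite Ea; ring).
replace (2 * a * (c - 1) * Rpower x (a - 1) * (Rpower t (- (1)) * gamma_density c t) +
   Rpower x a * Rabs (bessel_coef c k.+1) * x ^ k.+1 * (t ^ k.+1 * gamma_density c t))
 with ((Rpower t (- a) * gamma_density c t) *
   (2 * a * (c - 1) * Rpower y (a - 1) + Rpower y a * (Rabs (bessel_coef c k.+1) * y ^ k.+1))).
2: { rewrite Ea. unfold y at 3; rewrite Rpow_mult_distr.
     transitivity (2 * a * (c - 1) * gamma_density c t * (Rpower y (a - 1) * Rpower t (- a))
      + Rpower t (- a) * Rpower y a * Rabs (bessel_coef c k.+1) * (x ^ k.+1 * t ^ k.+1)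
          * gamma_density c t); [ring|].
     rewrite -Ea1; ring. }
rewrite Rabs_mult Rabs_right; [|apply Rle_ge, Rlt_le, Rmult_lt_0_compat; lra].
apply Rmult_le_compat_l; [apply Rlt_le, Rmult_lt_0_compat; lra|].
replace (L - Rpower y a * S0) with (- (Rpower y a * W - L) + Rpower y a * (W - S0)) by ring.
apply Rle_trans with (1 := Rabs_triang _ _).
rewrite Rabs_Ropp Rabs_mult (Rabs_right (Rpower y a)); [|lra].
apply Rplus_le_compat; auto; apply Rmult_le_compat_l; lra.
Qed.

(** Integral over t of the preceding bound.  By Gamma(c+m) = (c)_m Gamma(c)
    the sum for phi_c becomes the one for exp(-x). *)
Lemma gamma_average_bound (a c L x : R) (k : nat) : 0 < a < 1 -> 3 / 2 <= c -> 0 < x ->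
  (forall y, 0 < y ->
    Rabs (Rpower y a * PSeries (wavg a (bessel_coef c)) y - L) <= 2 * a * (c - 1) * Rpower y (a - 1)) ->
  Rabs (L * Gamma (c - a) - Gamma c * (Rpower x a * sum_f_R0 (fun m => wavg a expneg m * x ^ m) k))
  <= 2 * a * (c - 1) * Gamma (c - 1) * Rpower x (a - 1)
     + Gamma c * Rpower x a * (x ^ k.+1 / INR (Factorial.fact k.+1)).
Proof.
intros Ha Hc Hx HL.
assert (I1 := is_RInt_gen_scal (Fa := at_right 0) (Fb := Rbar_locally p_infty) _ L _ (proj1
    (gamma_primitive (c - a) ltac:(lra)))).
assert (I2 := is_RInt_gen_scal (Fa := at_right 0) (Fb := Rbar_locally p_infty) _ (Rpower x a) _
   (is_RInt_gen_gamma_sum c (fun m => wavg a (bessel_coef c) m * x ^ m) k ltac:(lra))).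
assert (I3 := is_RInt_gen_minus (Fa := at_right 0) (Fb := Rbar_locally p_infty) _ _ _ _ I1 I2).
assert (I4 := is_RInt_gen_scal (Fa := at_right 0) (Fb := Rbar_locally p_infty) _ (2 * a * (c - 1)
    * Rpower x (a - 1)) _ (proj1 (gamma_primitive (c - 1) ltac:(lra)))).
assert (Hk := pos_INR k.+1).
assert (I5 := is_RInt_gen_scal (Fa := at_right 0) (Fb := Rbar_locally p_infty) _ (Rpower x a
    * Rabs (bessel_coef c k.+1) * x ^ k.+1) _ (proj1 (gamma_primitive (c + INR k.+1) ltac:(lra)))).
assert (I6 := is_RInt_gen_plus (Fa := at_right 0) (Fb := Rbar_locally p_infty) _ _ _ _ I4 I5).
assert (N : Rabs (L * Gamma (c - a) - Rpower x a * sum_f_R0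
    (fun m => wavg a (bessel_coef c) m * x ^ m * Gamma (c + INR m)) k)
  <= 2 * a * (c - 1) * Rpower x (a - 1) * Gamma (c - 1)
     + Rpower x a * Rabs (bessel_coef c k.+1) * x ^ k.+1 * Gamma (c + INR k.+1)).
{ refine (RInt_gen_norm (V := R_CompleteNormedModule) (Fa := at_right 0) (Fb := Rbar_locally p_infty)
    _ _ _ _ _ _ I3 I6).
  - apply (near_0_infty (fun u v => u <= v)); intros; lra.
  - apply Filter_prod with (fun u => 0 < u) (fun _ => True).
    + exists (mkposreal 1 Rlt_0_1); auto.
    + now exists 0.
    + intros u v Hu _ t Ht; simpl in Ht.
      apply (gamma_average_pointwise a c L x t k Ha Hc Hx); [lra|exact HL]. }
assert (S : sum_f_R0 (fun m => wavg a (bessel_coef c) m * x ^ m * Gamma (c + INR m)) k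
  = Gamma c * sum_f_R0 (fun m => wavg a expneg m * x ^ m) k).
{ rewrite scal_sum; apply sum_eq; intros m _.
  rewrite Gamma_pochhammer; [|lra]; unfold wavg, bessel_coef, expneg.
  assert (Pp := pochhammer_gt0 c m ltac:(lra)); assert (F := INR_fact_lt_0 m); assert (H := pos_INR m).
  field; lra. }
rewrite S in N.
assert (B : Rabs (bessel_coef c k.+1) * Gamma (c + INR k.+1) = Gamma c / INR (Factorial.fact k.+1)).
{ assert (Pp := pochhammer_gt0 c k.+1 ltac:(lra)); assert (F := INR_fact_lt_0 k.+1).
  rewrite Gamma_pochhammer; [|lra]; unfold bessel_coef, Rdiv.
  rewrite Rabs_mult pow_1_abs Rabs_inv Rabs_right; [field; lra|].
  apply Rle_ge, Rlt_le, Rmult_lt_0_compat; auto. }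
replace (Gamma c * (Rpower x a * sum_f_R0 (fun m => wavg a expneg m * x ^ m) k)) with
  (Rpower x a * (Gamma c * sum_f_R0 (fun m => wavg a expneg m * x ^ m) k)) by ring.
apply Rle_trans with (1 := N); right.
transitivity (2 * a * (c - 1) * Rpower x (a - 1) * Gamma (c - 1) +
  Rpower x a * x ^ k.+1 * (Rabs (bessel_coef c k.+1) * Gamma (c + INR k.+1))); [ring|].
rewrite B; unfold Rdiv; ring.
Qed.

Lemma gamma_average_rate (a c L x : R) : 0 < a < 1 -> 3 / 2 <= c -> 0 < x ->
  (forall y, 0 < y ->
    Rabs (Rpower y a * PSeries (wavg a (bessel_coef c)) y - L) <= 2 * a * (c - 1) * Rpower y (a - 1)) ->
  Rabs (L * Gamma (c - a) - Gamma c * (Rpower x a * PSeries (wavg a expneg) x))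
  <= 2 * a * (c - 1) * Gamma (c - 1) * Rpower x (a - 1).
Proof.
intros Ha Hc Hx HL.
assert (Z : is_lim_seq (fun k => x ^ k / INR (Factorial.fact k)) 0).
{ apply is_lim_seq_Reals; apply cv_speed_pow_fact. }
assert (Sm : is_lim_seq (fun k => sum_f_R0
    (fun m => wavg a expneg m * x ^ m) k) (PSeries (wavg a expneg) x)).
{ apply is_lim_seq_ext with (sum_n (fun m => wavg a expneg m * x ^ m)).
  - intros k; apply sum_n_Reals.
  - apply Series_correct, ex_series_Rabs, CV_disk_inside, entire_inside, entire_wavg; [lra|apply
      entire_expneg]. }
assert (LE := is_lim_seq_le _ _
  (Rabs (L * Gamma (c - a) - Gamma c * (Rpower x a * PSeries (wavg a expneg) x)))
  (2 * a * (c - 1) * Gamma (c - 1) * Rpower x (a - 1) + Gamma c * Rpower x a * 0)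
  (fun k => gamma_average_bound a c L x k Ha Hc Hx HL)).
rewrite Rmult_0_r Rplus_0_r in LE; apply LE.
- apply (is_lim_seq_abs _ (L * Gamma (c - a) - Gamma c * (Rpower x a * PSeries (wavg a expneg) x))).
  apply is_lim_seq_minus'; [apply is_lim_seq_const|].
  apply (is_lim_seq_scal_l _ (Gamma c) (Rpower x a * PSeries (wavg a expneg) x)).
  now apply (is_lim_seq_scal_l _ (Rpower x a) (PSeries (wavg a expneg) x)).
- rewrite -{2}(Rplus_0_r (2 * a * (c - 1) * Gamma (c - 1) * Rpower x (a - 1))).
  apply is_lim_seq_plus'; [apply is_lim_seq_const|].
  rewrite -(Rmult_0_r (Gamma c * Rpower x a)).
  apply (is_lim_seq_scal_l _ (Gamma c * Rpower x a) 0).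
  now apply is_lim_seq_incr_1 in Z.
Qed.

(** The limit is a int_0^oo u^(a-1) phi_c(u) du.  As x grows, the preceding
    bound forces L Gamma(c-a) = Gamma(c) a Gamma(a). *)
Lemma wavg_phi_lim (a c : R) : 0 < a < 1 -> 3 / 2 <= c ->
  is_lim (fun x => Rpower x a * PSeries (wavg a (bessel_coef c)) x) p_infty
    (Gamma c * Gamma (a + 1) / Gamma (c - a)).
Proof.
intros Ha Hc; destruct (wavg_phi_rate a c Ha Hc) as [L HL].
assert (R1 : is_lim (fun x => Rpower x a * PSeries (wavg a (bessel_coef c)) x) p_infty L).
{ apply is_lim_of_rate with (2 * a * (c - 1)) (1 - a); [lra|].
  replace (- (1 - a)) with (a - 1) by ring; exact HL. }
assert (R2 : is_lim (fun x => Gamma c * (Rpower x a * PSeries (wavg a expneg) x)) p_infty (L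
    * Gamma (c - a))).
{ apply is_lim_of_rate with (2 * a * (c - 1) * Gamma (c - 1)) (1 - a); [lra|].
  replace (- (1 - a)) with (a - 1) by ring; intros x Hx.
  rewrite Rabs_minus_sym; now apply gamma_average_rate. }
assert (R3 := is_lim_scal_l _ (Gamma c) _ _ (proj2 (gamma_primitive a ltac:(lra)))).
apply is_lim_unique in R2; apply is_lim_unique in R3; rewrite R2 in R3; injection R3; intros E.
assert (G := Gamma_gt0 (c - a) ltac:(lra)).
rewrite Gamma_succ; [|lra].
replace (Gamma c * (a * Gamma a) / Gamma (c - a)) with L; [exact R1|].
rewrite -E; field; lra.
Qed.

(** * Decay of averaged Bessel functions *)

Lemma wavg_phi_decay (a c th x : R) :
  0 < a -> 3 / 2 <= c -> 0 <= th <= / 2 -> th < a -> 0 < x ->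
  Rabs (PSeries (wavg a (bessel_coef c)) x) <= c * (a / (a - th)) * Rpower x (- th).
Proof.
intros Ha Hc Hth Hta Hx; apply wavg_bound; auto; [apply entire_bessel; lra|].
intros t Ht; apply phi_decay; lra.
Qed.

Lemma wavg_phi_le1 (a c x : R) : 0 < a -> / 2 <= c -> 0 < x ->
  Rabs (PSeries (wavg a (bessel_coef c)) x) <= 1.
Proof.
intros Ha Hc Hx.
assert (E : forall t, 0 < t -> Rpower t (- 0) = 1) by (intros; rewrite Ropp_0; now apply Rpower_O).
assert (B := wavg_bound a 0 1 (bessel_coef c) Ha Ha (entire_bessel c ltac:(lra))).
apply Rle_trans with (1 * (a / (a - 0)) * Rpower x (- 0)).
- apply B; auto; intros t Ht; rewrite E // Rmult_1_l; apply phi_le1; lra.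
- right; rewrite E //; field; lra.
Qed.

Lemma PSeries_wavg_bessel_derive (a c x : R) : 1 < c ->
  PSeries (wavg a (PS_derive (bessel_coef (c - 1)))) x
      = - / (c - 1) * PSeries (wavg a (bessel_coef c)) x.
Proof.
intros Hc; rewrite -PSeries_scal; apply PSeries_ext; intros m.
unfold PS_scal, scal, wavg; simpl; unfold mult; simpl.
rewrite bessel_derive; [|lra]; replace (c - 1 + 1) with c by ring; ring.
Qed.

Lemma x_wavg1_phi (c x : R) : 1 < c ->
  x * PSeries (wavg 1 (bessel_coef c)) x = (c - 1) * (1 - phi (c - 1) x).
Proof.
intros Hc; assert (E := wavg1_derive (bessel_coef (c - 1)) x (entire_bessel (c - 1) ltac:(lra))).
rewrite PSeries_wavg_bessel_derive // in E; fold (phi (c - 1) x) in E.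
replace (bessel_coef (c - 1) O) with 1 in E by (unfold bessel_coef; simpl; field).
apply Rmult_eq_reg_l with (- / (c - 1)); [|assert (I := Rinv_0_lt_compat (c - 1) ltac:(lra)); lra].
replace (- / (c - 1) * (x * _)) with (x * (- / (c - 1) * PSeries (wavg 1 (bessel_coef c)) x)) by ring.
rewrite E; field; lra.
Qed.

(** Gains a factor x: the right-hand side is bounded for c >= 3/2, and
    tends to 0 for c >= 5/2. *)
Lemma x_wavg_phi (a c x : R) : 1 < a -> 1 < c ->
  x * PSeries (wavg a (bessel_coef c)) x
  = a * (c - 1) * (PSeries (wavg (a - 1) (bessel_coef (c - 1))) x - phi (c - 1) x).
Proof.
intros Ha Hc.
assert (E := wavg_derive_shift (a - 1) (bessel_coef (c - 1)) x ltac:(lra) (entire_bessel (c - 1)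
    ltac:(lra))).
replace (a - 1 + 1) with a in E by ring.
rewrite PSeries_wavg_bessel_derive // in E; fold (phi (c - 1) x) in E.
apply Rmult_eq_reg_l with (- / (c - 1)); [|assert (I := Rinv_0_lt_compat (c - 1) ltac:(lra)); lra].
replace (- / (c - 1) * (x * _)) with (x * (- / (c - 1) * PSeries (wavg a (bessel_coef c)) x)) by ring.
rewrite E; field; lra.
Qed.

Lemma is_lim_x_wavg1_phi (c : R) : 5 / 2 <= c ->
  is_lim (fun x => x * PSeries (wavg 1 (bessel_coef c)) x) p_infty (c - 1).
Proof.
intros Hc; apply is_lim_of_rate with ((c - 1) * (c - 1)) (/ 2); [lra|].
intros x Hx; rewrite x_wavg1_phi; [|lra].
replace (_ - _) with (- (c - 1) * phi (c - 1) x) by ring.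
rewrite Rabs_mult Rabs_Ropp Rabs_right; [|lra].
rewrite Rmult_assoc; apply Rmult_le_compat_l; [lra|]; apply phi_decay; lra.
Qed.

Lemma is_lim_x_wavg_phi (a c : R) : 1 < a -> 5 / 2 <= c ->
  is_lim (fun x => x * PSeries (wavg a (bessel_coef c)) x) p_infty 0.
Proof.
intros Ha Hc.
(* The average keeps decay x^(-th) for th < a - 1 only, and phi for th <= 1/2. *)
set (th := Rmin (a - 1) 1 / 2).
assert (Hth : 0 < th <= / 2 /\ th < a - 1).
{ unfold th, Rmin; destruct Rle_dec; lra. }
apply is_lim_of_rate with (a * (c - 1) * ((c - 1) * ((a - 1) / (a - 1 - th)) + (c - 1))) th; [lra|].
intros x Hx; rewrite x_wavg_phi; [|lra|lra].
assert (B1 := wavg_phi_decay (a - 1) (c - 1) th x ltac:(lra) ltac:(lra) ltac:(lra) ltac:(lra) Hx).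
assert (B2 := phi_decay (c - 1) th x ltac:(lra) ltac:(lra) Hx).
rewrite Rminus_0_r Rabs_mult (Rabs_right (a * (c - 1))); [|nra].
rewrite (Rmult_assoc (a * (c - 1))); apply Rmult_le_compat_l; [nra|].
apply Rle_trans with (1 := Rabs_triang _ _); rewrite Rabs_Ropp; lra.
Qed.

Lemma x_wavg_phi_bounded (a c x : R) : 1 <= a -> 3 / 2 <= c -> 0 < x ->
  Rabs (x * PSeries (wavg a (bessel_coef c)) x) <= 2 * a * (c - 1).
Proof.
intros Ha Hc Hx.
assert (B2 := phi_le1 (c - 1) x ltac:(lra) ltac:(lra)).
apply Rabs_le_between in B2.
destruct (Rle_lt_or_eq_dec _ _ Ha) as [H|<-].
- assert (B1 := wavg_phi_le1 (a - 1) (c - 1) x ltac:(lra) ltac:(lra) Hx).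
  apply Rabs_le_between in B1.
  rewrite x_wavg_phi; [|lra|lra].
  assert (0 < a * (c - 1)) by nra.
  apply Rabs_le_between; nra.
- rewrite x_wavg1_phi; [|lra]; apply Rabs_le_between; nra.
Qed.

Lemma is_lim_x_wavg_phi_sqr (a c : R) : 1 <= a -> 3 / 2 <= c ->
  is_lim (fun x => x * PSeries (wavg a (bessel_coef c)) x ^ 2) p_infty 0.
Proof.
intros Ha Hc; apply is_lim_of_rate with ((2 * a * (c - 1)) ^ 2) 1; [lra|].
intros x Hx; assert (B := x_wavg_phi_bounded a c x Ha Hc Hx).
rewrite Rpower_Ropp Rpower_1 // Rminus_0_r.
set (W := PSeries _ x) in *.
replace (x * W ^ 2) with ((x * W) ^ 2 * / x) by (field; lra).
assert (I := Rinv_0_lt_compat x Hx).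
rewrite Rabs_mult -RPow_abs (Rabs_right (/ x)); [|lra].
apply Rmult_le_compat_r; [lra|]; apply pow_incr; split; [apply Rabs_pos|exact B].
Qed.

(** The average must be o(x^(-a/2)).  It is O(x^(-th)) for each th < a with
    th <= 1/2, and a / (1 + a) is such an exponent greater than a / 2. *)
Lemma is_lim_Rpower_wavg_phi_sqr (a c : R) : 0 < a < 1 -> 3 / 2 <= c ->
  is_lim (fun x => Rpower x a * PSeries (wavg a (bessel_coef c)) x ^ 2) p_infty 0.
Proof.
intros Ha Hc.
set (th := a / (1 + a)).
assert (Hth : 0 < th /\ th < / 2 /\ th < a /\ a < 2 * th).
{ assert (E : th * (1 + a) = a) by (unfold th; field; lra).
  assert (0 < th) by (apply Rdiv_lt_0_compat; lra). repeat split; nra. }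
apply is_lim_of_rate with ((c * (a / (a - th))) ^ 2) (2 * th - a); [lra|].
intros x Hx; assert (B := wavg_phi_decay a c th x ltac:(lra) Hc ltac:(lra) ltac:(lra) Hx).
set (W := PSeries _ x) in *; assert (P := Rpower_gt0 x a).
rewrite Rminus_0_r Rabs_mult -RPow_abs (Rabs_right (Rpower x a)); [|lra].
replace (Rpower x (- (2 * th - a))) with (Rpower x a * (Rpower x (- th)) ^ 2).
2: { simpl; rewrite Rmult_1_r -!Rpower_plus; f_equal; ring. }
replace (_ * (Rpower x a * Rpower x (- th) ^ 2))
    with (Rpower x a * (c * (a / (a - th)) * Rpower x (- th)) ^ 2) by ring.
apply Rmult_le_compat_l; [lra|]; apply pow_incr; split; [apply Rabs_pos|exact B].
Qed.

(** The difference x W_1 W_1 phi_c - (c - 1) ln x converges, having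
    derivative - (c - 1) phi_(c-1) / x = O(x^(-3/2)). *)
Lemma is_lim_x_wavg11_phi (c : R) : 5 / 2 <= c ->
  is_lim (fun x => x * PSeries (wavg 1 (wavg 1 (bessel_coef c))) x / ln x) p_infty (c - 1).
Proof.
intros Hc.
assert (He := entire_wavg 1 _ Rlt_0_1 (entire_bessel c ltac:(lra))).
destruct (limit_of_derive_bound
  (fun x => Rpower x 1 * PSeries (wavg 1 (wavg 1 (bessel_coef c))) x + - (c - 1) * ln x)
  (fun x => 1 * Rpower x (1 - 1) * PSeries (wavg 1 (bessel_coef c)) x + - (c - 1) * / x)
  (2 * ((c - 1) * (c - 1))) (/ 2)) as [L HL].
- lra.
- intros t Ht.
  apply (is_derive_plus (V := R_NormedModule)
      (fun x => Rpower x 1 * PSeries (wavg 1 (wavg 1 (bessel_coef c))) x)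
    (fun x => - (c - 1) * ln x)).
  + apply is_derive_wavg; auto; lra.
  + apply (is_derive_scal ln); now apply is_derive_ln.
- intros t Ht.
  rewrite Rminus_diag Rpower_O // !Rmult_1_l.
  assert (E := x_wavg1_phi c t ltac:(lra)).
  replace (PSeries (wavg 1 (bessel_coef c)) t + - (c - 1) * / t) with (- (c - 1) * phi (c - 1) t * / t).
  2: { replace (PSeries (wavg 1 (bessel_coef c)) t)
      with (t * PSeries (wavg 1 (bessel_coef c)) t * / t) by (field; lra).
       rewrite E; ring. }
  assert (I := Rinv_0_lt_compat t Ht).
  rewrite !Rabs_mult Rabs_Ropp (Rabs_right (c - 1)) ?(Rabs_right (/ t)); [|lra|lra].
  replace (Rpower t (- / 2 - 1)) with (Rpower t (- / 2) * / t).
  2: { rewrite /Rminus Rpower_plus (Rpower_Ropp t 1) Rpower_1 //. }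
  assert (B := phi_decay (c - 1) (/ 2) t ltac:(lra) ltac:(lra) Ht).
  replace (2 * ((c - 1) * (c - 1)) * / 2 * (Rpower t (- / 2) * / t)) with
    ((c - 1) * ((c - 1) * Rpower t (- / 2)) * / t) by (field; lra).
  apply Rmult_le_compat_r; [lra|]; apply Rmult_le_compat_l; [lra|exact B].
- assert (D := is_lim_of_rate _ _ _ (/ 2) ltac:(lra) HL).
  apply is_lim_ext_loc with
   (fun x => (Rpower x 1 * PSeries (wavg 1 (wavg 1 (bessel_coef c))) x
       + - (c - 1) * ln x) * (1 / ln x) + (c - 1)).
  + exists 1; intros x Hx; rewrite Rpower_1; [|lra]; assert (H := ln_gt0 x Hx); field; lra.
  + replace (Finite (c - 1)) with (Finite (L * 0 + (c - 1))) by (f_equal; ring).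
    apply is_lim_plus'; [|apply is_lim_const].
    apply is_lim_mult_R; [exact D|apply is_lim_const_over_ln].
Qed.

(** * The profile of the eigenvalue and its equivalent *)

(** The average of parameter c - 1 is 1F2; the other two make up 3F4. *)
Definition profile (a c k x : R) : R :=
  x * (2 * PSeries (wavg a (bessel_coef c)) x + PSeries (wavg 1 (wavg a (bessel_coef c))) x
       + k * PSeries (wavg a (bessel_coef (c - 1))) x ^ 2).

Lemma is_lim_profile_gt1 (a c k : R) : 1 < a -> 5 / 2 <= c ->
  is_lim (profile a c k) p_infty (a / (a - 1) * (c - 1)).
Proof.
intros Ha Hc.
apply is_lim_ext with (fun x => (2 - 1 / (a - 1)) * (x * PSeries (wavg a (bessel_coef c)) x)
  + a / (a - 1) * (x * PSeries (wavg 1 (bessel_coef c)) x)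
  + k * (x * PSeries (wavg a (bessel_coef (c - 1))) x ^ 2)).
- intros x; unfold profile; rewrite wavg1_wavg; [ring|lra|lra|apply entire_bessel; lra].
- replace (Finite (a / (a - 1) * (c - 1))) with
   (Finite ((2 - 1 / (a - 1)) * 0 + a / (a - 1) * (c - 1) + k * 0)) by (f_equal; ring).
  repeat apply is_lim_plus'.
  + apply (is_lim_scal_l _ _ p_infty 0); now apply is_lim_x_wavg_phi.
  + apply (is_lim_scal_l _ _ p_infty (c - 1)); now apply is_lim_x_wavg1_phi.
  + apply (is_lim_scal_l _ _ p_infty 0); apply is_lim_x_wavg_phi_sqr; lra.
Qed.

Lemma is_lim_profile_eq1 (c k : R) : 5 / 2 <= c ->
  is_lim (fun x => profile 1 c k x / ln x) p_infty (c - 1).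
Proof.
intros Hc.
apply is_lim_ext with (fun x => x * PSeries (wavg 1 (wavg 1 (bessel_coef c))) x / ln x
  + (2 * (x * PSeries (wavg 1 (bessel_coef c)) x)
      + k * (x * PSeries (wavg 1 (bessel_coef (c - 1))) x ^ 2)) * (1 / ln x)).
- intros x; unfold profile, Rdiv; ring.
- replace (Finite (c - 1)) with (Finite (c - 1 + (2 * (c - 1) + k * 0) * 0)) by (f_equal; ring).
  apply is_lim_plus'; [now apply is_lim_x_wavg11_phi|].
  apply is_lim_mult_R; [|apply is_lim_const_over_ln].
  apply is_lim_plus'.
  + apply (is_lim_scal_l _ _ p_infty (c - 1)); now apply is_lim_x_wavg1_phi.
  + apply (is_lim_scal_l _ _ p_infty 0); apply is_lim_x_wavg_phi_sqr; lra.
Qed.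

Lemma is_lim_profile_lt1 (a c k : R) : 0 < a < 1 -> 5 / 2 <= c ->
  is_lim (fun x => profile a c k x / Rpower x (1 - a)) p_infty
    ((2 - 1 / (a - 1)) * (Gamma c * Gamma (a + 1) / Gamma (c - a))).
Proof.
intros Ha Hc.
apply is_lim_ext_loc with (fun x => (2 - 1 / (a - 1)) * (Rpower x a * PSeries (wavg a (bessel_coef c)) x)
  + a / (a - 1) * (Rpower x (- (1 - a)) * (x * PSeries (wavg 1 (bessel_coef c)) x))
  + k * (Rpower x a * PSeries (wavg a (bessel_coef (c - 1))) x ^ 2)).
- exists 0; intros x Hx; unfold profile; rewrite wavg1_wavg; [|lra|lra|apply entire_bessel; lra].
  assert (P := Rpower_gt0 x (1 - a)).
  replace (Rpower x a) with (x * / Rpower x (1 - a)).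
  + rewrite Rpower_Ropp; field; lra.
  + rewrite -Rpower_Ropp -{1}(Rpower_1 x Hx) -Rpower_plus; f_equal; ring.
- set (G := Gamma c * Gamma (a + 1) / Gamma (c - a)).
  replace (Finite ((2 - 1 / (a - 1)) * G)) with
   (Finite ((2 - 1 / (a - 1)) * G + a / (a - 1) * (0 * (c - 1)) + k * 0)) by (f_equal; ring).
  repeat apply is_lim_plus'.
  + apply (is_lim_scal_l _ _ p_infty G); apply wavg_phi_lim; lra.
  + apply (is_lim_scal_l _ _ p_infty (0 * (c - 1))).
    apply is_lim_mult_R; [apply Rpower_lim_infty; lra|now apply is_lim_x_wavg1_phi].
  + apply (is_lim_scal_l _ _ p_infty 0); apply is_lim_Rpower_wavg_phi_sqr; lra.
Qed.

(** The claimed equivalent in the variable x, up to the factor - 4 mu / delta^2;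
    K, G and h stand for its Gamma and digamma constants. *)
Definition profile_asymp (a c K G h x : R) : R :=
  K * Rpower x (1 - 2 * a) +
  (if Req_dec_T a 1 then (c - 1) * (ln x + h)
   else a / (a - 1) * (c - 1) + (2 - 1 / (a - 1)) * G * Rpower x (1 - a)).

(** Divide both sides by the dominant scale: ln x for a = 1, x^(1-a) for
    a < 1, and 1 for a > 1. *)
Lemma profile_equiv (a c k K G h : R) : 0 < a -> 5 / 2 <= c ->
  (a < 1 -> G = Gamma c * Gamma (a + 1) / Gamma (c - a)) ->
  is_lim (fun x => profile a c k x / profile_asymp a c K G h x) p_infty 1.
Proof.
intros Ha Hc HG; unfold profile_asymp.
destruct (Req_dec_T a 1) as [->|Ha1]; cbn [is_left]; [|destruct (Rlt_le_dec a 1) as [H|H]].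
- apply equiv_of_common_scale with ln (c - 1); [lra| | |].
  + intros x Hx; assert (L := ln_gt0 x Hx); lra.
  + now apply is_lim_profile_eq1.
  + apply is_lim_ext_loc with
      (fun x => K * Rpower x (- (1)) * (1 / ln x) + ((c - 1) + ((c - 1) * h) / ln x)).
    * exists 1; intros x Hx; assert (L := ln_gt0 x Hx).
      replace (1 - 2 * 1) with (- (1)) by ring; field; lra.
    * replace (Finite (c - 1)) with (Finite (K * 0 * 0 + ((c - 1) + 0))) by (f_equal; ring).
      apply is_lim_plus'; [|apply is_lim_plus'; [apply is_lim_const|apply is_lim_const_over_ln]].
      apply is_lim_mult_R; [|apply is_lim_const_over_ln].
      apply (is_lim_scal_l _ _ p_infty 0); apply Rpower_lim_infty; lra.
- set (G' := Gamma c * Gamma (a + 1) / Gamma (c - a)) in HG.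
  assert (G0 : 0 < G').
  { apply Rdiv_lt_0_compat; [apply Rmult_lt_0_compat|]; apply Gamma_gt0; lra. }
  assert (C0 : 0 < 2 - 1 / (a - 1)).
  { assert (N : / (a - 1) < 0) by (apply Rinv_lt_0_compat; lra); lra. }
  rewrite (HG H).
  apply equiv_of_common_scale with (fun x => Rpower x (1 - a)) ((2 - 1 / (a - 1)) * G').
  + assert (0 < (2 - 1 / (a - 1)) * G') by (now apply Rmult_lt_0_compat); lra.
  + intros x Hx; assert (P := Rpower_gt0 x (1 - a)); lra.
  + apply is_lim_profile_lt1; lra.
  + apply is_lim_ext_loc with
      (fun x => K * Rpower x (- a) + (a / (a - 1) * (c - 1) * Rpower x (- (1 - a))
          + (2 - 1 / (a - 1)) * G')).
    * exists 0; intros x Hx; replace (1 - 2 * a)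
        with (- a + (1 - a)) by ring; rewrite Rpower_plus (Rpower_Ropp x (1 - a)).
      assert (P := Rpower_gt0 x (1 - a)); field; lra.
    * replace (Finite ((2 - 1 / (a - 1)) * G')) with
        (Finite (K * 0 + (a / (a - 1) * (c - 1) * 0 + (2 - 1 / (a - 1)) * G'))) by (f_equal; ring).
      repeat apply is_lim_plus'; [| |apply is_lim_const].
      -- apply (is_lim_scal_l _ _ p_infty 0); apply Rpower_lim_infty; lra.
      -- apply (is_lim_scal_l _ _ p_infty 0); apply Rpower_lim_infty; lra.
- assert (Ha2 : 1 < a) by lra.
  assert (I : 0 < / (a - 1)) by (apply Rinv_0_lt_compat; lra).
  apply equiv_of_common_scale with (fun _ => 1) (a / (a - 1) * (c - 1)).
  + assert (0 < a / (a - 1) * (c - 1)); [|lra].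
    apply Rmult_lt_0_compat; [apply Rmult_lt_0_compat|]; lra.
  + intros; lra.
  + apply is_lim_ext with (profile a c k); [intros; field|]. now apply is_lim_profile_gt1.
  + apply is_lim_ext with (fun x => K * Rpower x (- (2 * a - 1)) + (a / (a - 1) * (c - 1)
      + (2 - 1 / (a - 1)) * G * Rpower x (- (a - 1)))).
    * intros x; rewrite !Ropp_minus_distr; field; lra.
    * replace (Finite (a / (a - 1) * (c - 1))) with
        (Finite (K * 0 + (a / (a - 1) * (c - 1) + (2 - 1 / (a - 1)) * G * 0))) by (f_equal; ring).
      repeat apply is_lim_plus'; [|apply is_lim_const|].
      -- apply (is_lim_scal_l _ _ p_infty 0); apply Rpower_lim_infty; lra.
      -- apply (is_lim_scal_l _ _ p_infty 0); apply Rpower_lim_infty; lra.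
Qed.

(** * The eigenvalue in terms of its profile *)

Lemma pochhammer_succ_param (a : R) (m : nat) :
  a * pochhammer (a + 1) m = pochhammer a m * (a + INR m).
Proof. exact (Logic.eq_sym (pochhammer_shift a m)). Qed.

Lemma hypergeom_1F2 (a c x : R) : 0 < a -> 0 < c ->
  hypergeom [:: a] [:: c; a + 1] (- x) = PSeries (wavg a (bessel_coef c)) x.
Proof.
intros Ha Hc; apply Series_ext; intros m.
unfold pochhammers, wavg, bessel_coef; simpl.
assert (P := pochhammer_gt0 a m Ha); assert (Pc := pochhammer_gt0 c m Hc).
assert (F := INR_fact_lt_0 m); assert (H := pos_INR m).
replace (pochhammer (a + 1) m) with (pochhammer a m * (a + INR m) / a)
  by (rewrite -pochhammer_succ_param; field; lra).
replace (- x) with (-1 * x) by ring; rewrite Rpow_mult_distr; field; lra.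
Qed.

(** (1)_m / (2)_m = 1 / (m + 1) and (5/2)_m / (3/2)_m = (2 m + 3) / 3, so the
    extra factor in the m-th term is 3 (2 m + 3) / (3 (m + 1)) = 2 + 1 / (m + 1). *)
Lemma hypergeom_3F4 (a c x : R) : 0 < a -> 0 < c ->
  3 * hypergeom [:: 1; 5 / 2; a] [:: 2; 3 / 2; c; a + 1] (- x)
  = 2 * PSeries (wavg a (bessel_coef c)) x + PSeries (wavg 1 (wavg a (bessel_coef c))) x.
Proof.
intros Ha Hc.
assert (He := entire_wavg a _ Ha (entire_bessel c Hc)).
rewrite -(Rmult_1_l (PSeries (wavg 1 _) x)) -PSeries_lincomb //; [|apply entire_wavg; auto; lra].
unfold hypergeom; rewrite -Series_scal_l; apply Series_ext; intros m.
unfold pochhammers; simpl.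
assert (P := pochhammer_gt0 a m Ha); assert (Pc := pochhammer_gt0 c m Hc).
assert (P1 := pochhammer_gt0 1 m ltac:(lra)); assert (P3 := pochhammer_gt0 (3 / 2) m ltac:(lra)).
assert (F := INR_fact_lt_0 m); assert (H := pos_INR m).
replace (pochhammer (a + 1) m) with (pochhammer a m * (a + INR m) / a)
  by (rewrite -pochhammer_succ_param; field; lra).
replace (pochhammer 2 m) with (pochhammer 1 m * (1 + INR m) / 1)
  by (rewrite -pochhammer_succ_param; replace (1 + 1) with 2 by ring; field).
replace (pochhammer (5 / 2) m) with (pochhammer (3 / 2) m * (3 / 2 + INR m) / (3 / 2))
  by (rewrite -pochhammer_succ_param; replace (3 / 2 + 1) with (5 / 2) by field; field).
replace (- x) with (-1 * x) by ring; rewrite Rpow_mult_distr; unfold wavg, bessel_coef; field; lra.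
Qed.

(** For x > 1 no shift is made in the definition of 1/Gamma. *)
Lemma rGamma_gt1 (x : R) : 1 < x -> rGamma x = / Gamma x.
Proof.
intros Hx; unfold rGamma.
replace (Z.to_nat (up (- x))) with O.
- simpl; rewrite Rplus_0_r; unfold Rdiv; ring.
- assert (U := archimed (- x)).
  assert (L : (up (- x) < 1)%Z) by (apply lt_IZR; simpl; lra).
  lia.
Qed.

Lemma lambda1_profile (n : nat) (delta beta mu lambdastar : R) (nu : 'rV[R]_n) :
  0 < delta -> beta < INR n + 2 -> 0 < mu ->
  lambda1 delta beta mu lambdastar nu =
  - (4 * mu / delta ^ 2) * profile ((INR n + 2 - beta) / 2) ((INR n + 4) / 2) ((lambdastar - mu) / mu)
       (enorm nu ^ 2 * delta ^ 2 / 4).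
Proof.
intros Hd Hb Hm; unfold lambda1, profile.
assert (Hn := pos_INR n).
set (a := (INR n + 2 - beta) / 2); set (c := (INR n + 4) / 2); set (x := enorm nu ^ 2 * delta ^ 2 / 4).
replace (- (1 / 4) * enorm nu ^ 2 * delta ^ 2) with (- x) by (unfold x; field).
replace ((INR n + 4 - beta) / 2) with (a + 1) by (unfold a; field).
replace ((INR n + 2) / 2) with (c - 1) by (unfold c; field).
rewrite hypergeom_1F2; [|unfold a; lra|unfold c; lra].
replace (3 * mu * _) with (mu * (3 * hypergeom [:: 1; 5 / 2; a] [:: 2; 3 / 2; c; a + 1] (- x))) by ring.
rewrite hypergeom_3F4; [|unfold a; lra|unfold c; lra].
replace (enorm nu ^ 2) with (4 * x / delta ^ 2) by (unfold x; field; lra).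
field; lra.
Qed.

(** With ||nu|| = (2 / delta) x^(1/2), the powers of 2 / delta attached to
    ||nu||^(beta - n) add up to (2 / delta)^2. *)
Lemma lambda1_asymp_profile (n : nat) (delta beta mu lambdastar : R) :
  0 < delta -> beta < INR n + 2 -> 0 < mu -> (1 <= INR n) ->
  exists K G h,
    ((INR n + 2 - beta) / 2 < 1 ->
      G = Gamma ((INR n + 4) / 2) * Gamma ((INR n + 2 - beta) / 2 + 1)
          / Gamma ((INR n + 4) / 2 - (INR n + 2 - beta) / 2)) /\
    forall nu : 'rV[R]_n, 0 < enorm nu ->
      lambda1_asymp delta beta mu lambdastar nu =
      - (4 * mu / delta ^ 2) *
        profile_asymp ((INR n + 2 - beta) / 2) ((INR n + 4) / 2) K G h
         (enorm nu ^ 2 * delta ^ 2 / 4).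
Proof.
intros Hd Hb Hm Hn.
set (a := (INR n + 2 - beta) / 2); set (c := (INR n + 4) / 2).
set (A := (lambdastar - mu) *
    (Gamma ((INR n + 2) / 2) * Gamma ((INR n + 4 - beta) / 2) * rGamma (beta / 2)) ^ 2 *
    Rpower (2 / delta) (2 * (INR n + 2 - beta))).
exists (delta ^ 2 / (4 * mu) * A * Rpower (2 / delta) (2 - 4 * a)).
exists (Gamma c * Gamma (a + 1) * rGamma (c - a)).
exists (euler_gamma + 2 - digamma ((INR n + 2) / 2)).
split.
- intros Ha; rewrite rGamma_gt1 //; unfold c, a in *; lra.
- intros nu Hr; unfold lambda1_asymp, remainder, profile_asymp; set (r := enorm nu) in *.
  set (x := r ^ 2 * delta ^ 2 / 4).
  assert (H2d : 0 < 2 / delta) by (apply Rdiv_lt_0_compat; lra).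
  assert (Hx : 0 < x).
  { unfold x; apply Rdiv_lt_0_compat; [apply Rmult_lt_0_compat; apply pow_lt|]; lra. }
  assert (Er : r = 2 / delta * Rpower x (/ 2)).
  { rewrite Rpower_sqrt //; unfold x.
    replace (r ^ 2 * delta ^ 2 / 4) with ((r * delta / 2) ^ 2) by field.
    rewrite sqrt_pow2; [field; lra|].
    apply Rlt_le, Rdiv_lt_0_compat; [apply Rmult_lt_0_compat|]; lra. }
  assert (Ep : forall e, Rpower r e = Rpower (2 / delta) e * Rpower x (e / 2)).
  { intros e; rewrite {1}Er -Rpower_mult_distr //; [|apply Rpower_gt0].
    rewrite Rpower_mult; f_equal; f_equal; field. }
  rewrite !Ep.
  replace (2 * (beta - (INR n + 1))) with (2 - 4 * a) by (unfold a; field).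
  replace ((2 - 4 * a) / 2) with (1 - 2 * a) by field.
  (* A is hidden from the case analysis below, whose rewriting of the parameters
     would otherwise reach inside it. *)
  assert (EA : - (lambdastar - mu) *
    (Gamma ((INR n + 2) / 2) * Gamma ((INR n + 4 - beta) / 2) * rGamma (beta / 2)) ^ 2 *
    Rpower (2 / delta) (2 * (INR n + 2 - beta)) * (Rpower (2 / delta) (2 - 4 * a) * Rpower x (1 - 2 * a))
    = - A * Rpower (2 / delta) (2 - 4 * a) * Rpower x (1 - 2 * a)) by (unfold A; ring).
  rewrite EA; clear EA; clearbody A.
  destruct (Req_dec_T beta (INR n)) as [E|E]; destruct (Req_dec_T a 1) as [E'|E']; cbn [is_left].
  + assert (El : 2 * ln r = ln x - ln (delta ^ 2 / 4)).
    { rewrite -ln_div //; [|apply Rdiv_lt_0_compat; [apply pow_lt|]; lra].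
      replace (x / (delta ^ 2 / 4)) with (r * r) by (unfold x; field; lra).
      rewrite ln_mult //; ring. }
    rewrite El; unfold c; field; lra.
  + contradict E'; unfold a; lra.
  + contradict E; unfold a in E'; lra.
  + replace (beta - INR n) with (2 - 2 * a) by (unfold a; field).
    replace ((2 - 2 * a) / 2) with (1 - a) by field.
    replace (INR n + 2 - beta) with (2 * a) by (unfold a; field).
    replace (INR n - beta - 1) with (2 * a - 3) by (unfold a; field).
    replace (INR n - beta) with (2 * a - 2) by (unfold a; field).
    replace ((INR n + 4 - beta) / 2) with (a + 1) by (unfold a; field).
    replace ((beta + 2) / 2) with (c - a) by (unfold a, c; field).
    replace (INR n + 2) with (2 * (c - 1)) by (unfold c; field).
    fold c; set (G := Gamma c * _ * _).
    transitivity (- A * Rpower (2 / delta) (2 - 4 * a) * Rpower x (1 - 2 * a) +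
     (- mu * (2 * (2 * a) * (2 * (c - 1)) / (delta ^ 2 * (2 * a - 2))) -
     2 * mu * ((2 * a - 3) / (2 * a - 2)) * G * (Rpower (2 / delta) (2 * a)
         * Rpower (2 / delta) (2 - 2 * a)) * Rpower x (1 - a))).
    * ring.
    * rewrite -Rpower_plus; replace (2 * a + (2 - 2 * a)) with (INR 2) by (simpl; ring).
      rewrite Rpower_pow //; field; lra.
Qed.

Theorem theorem9 (n : nat) (delta beta mu lambdastar : R)
  (hn : (1 <= n)%nat) (hdelta : 0 < delta) (hbeta : beta < INR n + 2)
  (hmu : 0 < mu)
  (hneg : forall nu : 'rV[R]_n, nu <> const_mx 0 ->
            lambda1 delta beta mu lambdastar nu < 0) :
  asymp_equiv (fun nu : 'rV[R]_n => lambda1 delta beta mu lambdastar nu)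
              (fun nu : 'rV[R]_n => lambda1_asymp delta beta mu lambdastar nu).
Proof.
assert (Hn : 1 <= INR n) by (move/leP: hn => hn; apply (le_INR 1); lia).
destruct (lambda1_asymp_profile n delta beta mu lambdastar hdelta hbeta hmu Hn) as [K [G [h [HG E]]]].
set (a := (INR n + 2 - beta) / 2) in *; set (c := (INR n + 4) / 2) in *.
assert (Lim := profile_equiv a c ((lambdastar - mu) / mu) K G h ltac:(unfold a; lra) ltac:(unfold
    c; lra) HG).
intros P HP; destruct (Lim P HP) as [M HM].
(* Beyond 1, ||nu||^2 >= ||nu||, so a threshold linear in M makes x > M. *)
exists (Rmax 1 (4 * M / delta ^ 2)); intros nu Hnu.
assert (H1 := Rmax_l 1 (4 * M / delta ^ 2)); assert (H2 := Rmax_r 1 (4 * M / delta ^ 2)).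
assert (D2 : 0 < delta ^ 2) by (now apply pow_lt).
rewrite lambda1_profile // E; [|lra]; fold a c.
set (x := enorm nu ^ 2 * delta ^ 2 / 4).
assert (Hx : M < x).
{ apply Rlt_le_trans with (enorm nu * delta ^ 2 / 4).
  - apply Rmult_lt_reg_r with (4 / delta ^ 2); [apply Rdiv_lt_0_compat; lra|].
    replace (enorm nu * delta ^ 2 / 4 * (4 / delta ^ 2)) with (enorm nu) by (field; lra).
    replace (M * (4 / delta ^ 2)) with (4 * M / delta ^ 2) by (field; lra); lra.
  - unfold x, Rdiv; apply Rmult_le_compat_r; [lra|]; apply Rmult_le_compat_r; [lra|]; nra. }
replace (_ / _) with (profile a c ((lambdastar - mu) / mu) x / profile_asymp a c K G h x).
- now apply HM.
- assert (N : - (4 * mu / delta ^ 2) <> 0).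
  { assert (0 < 4 * mu / delta ^ 2) by (apply Rdiv_lt_0_compat; lra); lra. }
  set (s := - (4 * mu / delta ^ 2)) in *; clearbody s.
  set (p := profile _ _ _ _); set (q := profile_asymp _ _ _ _ _ _).
  unfold Rdiv; rewrite Rinv_mult.
  transitivity (p * / q * (s * / s)); [rewrite Rinv_r //|]; ring.
Qed.
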